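(* For each composition $\alpha$ of $n$ and $\sigma\in\mathfrak{S}_{\ell(\alpha)}$ (where $\ell(\alpha)$ is the number of parts of $\alpha$), the rule $$\pi_i\cdot T:=\begin{cases}T&\text{if } i+1 \text{ is weakly left of } i \text{ in } T,\\ 0&\text{if } i+1 \text{ is right-adjacent to } i \text{ in } T,\\ s_i\cdot T&\text{otherwise}\end{cases}\qquad(1\le i\le n-1,\ T\in\mathrm{SPYRT}^\sigma(\alpha))$$ defines an $H_n(0)$-action on $\mathbf{R}^\sigma_\alpha$, the $\mathbb{C}$-span of $\mathrm{SPYRT}^\sigma(\alpha)$, where $s_i\cdot T$ is obtained from $T$ by swapping $i$ and $i+1$. Moreover, the linear map $$\mathcal{W}:\mathbf{R}^\sigma_\alpha\to\widehat{\omega}\big[\mathbf{S}^{\sigma^{w_0}}_{\alpha^{\mathrm r}}\big],\qquad \mathcal{W}(T)=(-1)^{\mathrm{rank}(\tau_T)}\,\tau_T^*\quad(T\in\mathrm{SPYRT}^\sigma(\alpha)),$$ is an $H_n(0)$-module isomorphism.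
   Context: $H_n(0)$ is the unital $\mathbb{C}$-algebra generated by $\pi_1,\dots,\pi_{n-1}$ with relations $\pi_i^2=\pi_i$, $\pi_i\pi_{i+1}\pi_i=\pi_{i+1}\pi_i\pi_{i+1}$, $\pi_i\pi_j=\pi_j\pi_i$ for $|i-j|\ge2$; $\pi_\gamma$ is the product of the $\pi_i$ along any reduced expression of $\gamma\in\mathfrak{S}_n$, $\ell$ is the Coxeter length. For $\alpha=(\alpha_1,\dots,\alpha_k)$, $\alpha^{\mathrm r}=(\alpha_k,\dots,\alpha_1)$; for $\sigma\in\mathfrak{S}_k$, $\sigma^{w_0}=w_0\sigma w_0$ with $w_0$ the longest element of $\mathfrak{S}_k$. The composition diagram of $\beta=(\beta_1,\dots,\beta_k)$ is the left-justified array of boxes whose $i$th row from the top has $\beta_i$ boxes; $\tau_{i,j}$ denotes the entry of a filling $\tau$ in row $i$ (from the top) and column $j$ (from the left). A standard permuted Young row-strict composition tableau (SPYRT) of shape $\alpha$ and type $\sigma$ is a filling $T$ of the composition diagram of $\alpha^{\mathrm r}$ with $1,\dots,n$ such that: (1) entries are all distinct; (2) the standardization of the word obtained by reading the first column from bottom to top is $\sigma$; (3) entries in each row increase from left to right; (4) if $i<j$ and $T_{i,k}<T_{j,k+1}$, then $(i,k+1)$ is a box of the diagram and $T_{i,k+1}<T_{j,k+1}$. The set of these is $\mathrm{SPYRT}^\sigma(\alpha)$. ''$i+1$ is right-adjacent to $i$'' means $i+1$ is in the box immediately to the right of $i$ in the same row. A standard permuted composition tableau of shape $\beta$ and type $\upsilon$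 is a filling $\tau$ of the composition diagram of $\beta$ with $1,\dots,n$ such that: entries are all distinct; the standardization of the first column read from top to bottom is $\upsilon$; rows decrease from left to right; and if $i<j$ and $\tau_{i,k}>\tau_{j,k+1}$, then $(i,k+1)$ is a box and $\tau_{i,k+1}>\tau_{j,k+1}$. The set of these is $\mathrm{SPCT}^\upsilon(\beta)$. $\mathbf{S}^\upsilon_\beta$ is the $H_n(0)$-module with basis $\mathrm{SPCT}^\upsilon(\beta)$ and action: $\pi_i\cdot\tau=\tau$ if $i+1$ is strictly left of $i$; if $i+1$ is weakly right of $i$, then $\pi_i\cdot\tau=0$ when $i,i+1$ are in the same column, or $i+1$ is in the column immediately to the right of that of $i$ and in a strictly lower row; otherwise $\pi_i\cdot\tau$ is $\tau$ with $i$ and $i+1$ swapped. Two such tableaux are equivalent if for every $k$ the relative orders of the entries in their $k$th columns agree. Each equivalence class $E$ together with $0$ is closed under the action and has a unique source $\tau_E\in E$ (for every $\tau\in E$ there is $\gamma$ with $\pi_\gamma\cdot\tau_E=\tau$). For $T\in\mathrm{SPYRT}^\sigma(\alpha)$, $\tau_T\in\mathrm{SPCT}^{\sigma^{w_0}}(\alpha^{\mathrm r})$ is the filling with $(\tau_T)_{i,j}=n+1-T_{i,j}$; $\tau_T^*$ is the dual basis element with respect to the basis $\mathrm{SPCT}^{\sigma^{w_0}}(\alpha^{\mathrm r})$; $\mathrm{rank}(\tau_T)=\min\{\ell(\gamma)\mid\gamma\in\mathfrak{S}_n,\ \pi_\gamma\cdot\tau_E=\tau_T\}$ where $E$ is the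 equivalence class of $\tau_T$. $\widehat{\omega}$ is the algebra anti-involution of $H_n(0)$ with $\widehat{\omega}(\pi_i)=1-\pi_{n-i}$. For a module $M$, $\widehat{\omega}[M]$ is the dual space $M^*$ with action $(a\cdot\delta)(v)=\delta(\widehat{\omega}(a)\cdot v)$. *)

(* Defs.v *)
From HB Require Import structures.
From mathcomp Require Import all_boot all_order all_algebra all_fingroup.
From mathcomp Require Import boolp zify.

Set Implicit Arguments.
Unset Strict Implicit.
Unset Printing Implicit Defensive.

Import GRing.Theory.
Local Open Scope ring_scope.
Local Open Scope quotient_scope.

Local Notation hrep := generic_quotient.repr.

(* Indices are 0-based throughout: i : 'I_n.-1 stands for the index i + 1 of   *)
(* the generator pi_(i+1), an entry e : 'I_n of a filling stands for e + 1, and *)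
(* rows and columns are counted from 0.  Hence rev_ord : 'I_n.-1 -> 'I_n.-1     *)
(* encodes i |-> n - i, and rev_ord : 'I_n -> 'I_n encodes e |-> n + 1 - e.     *)

(* The presented algebra: expressions in the generators, modulo the least       *)
(* congruence containing the axioms of unital F-algebras and the relations.     *)
Section ZeroHecke.

Variables (F : fieldType) (n : nat).

Inductive hterm : Type :=
| Scal of F
| Gen of 'I_n.-1
| Add of hterm & hterm
| Mul of hterm & hterm.

Inductive hcong : hterm -> hterm -> Prop :=
| hc_refl s : hcong s s
| hc_sym s t : hcong s t -> hcong t s
| hc_trans s t u : hcong s t -> hcong t u -> hcong s u
| hc_add s s' t t' : hcong s s' -> hcong t t' -> hcong (Add s t) (Add s' t')
| hc_mul s s' t t' : hcong s s' -> hcong t t' -> hcong (Mul s t) (Mul s' t')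
| hc_addA s t u : hcong (Add s (Add t u)) (Add (Add s t) u)
| hc_addC s t : hcong (Add s t) (Add t s)
| hc_add0 s : hcong (Add (Scal 0) s) s
| hc_addN s : hcong (Add (Mul (Scal (-1)) s) s) (Scal 0)
| hc_mulA s t u : hcong (Mul s (Mul t u)) (Mul (Mul s t) u)
| hc_mul1l s : hcong (Mul (Scal 1) s) s
| hc_mul1r s : hcong (Mul s (Scal 1)) s
| hc_mulDl s t u : hcong (Mul (Add s t) u) (Add (Mul s u) (Mul t u))
| hc_mulDr s t u : hcong (Mul s (Add t u)) (Add (Mul s t) (Mul s u))
| hc_scalD c d : hcong (Scal (c + d)) (Add (Scal c) (Scal d))
| hc_scalM c d : hcong (Scal (c * d)) (Mul (Scal c) (Scal d))
| hc_scalC c s : hcong (Mul (Scal c) s) (Mul s (Scal c))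
| hc_idem i : hcong (Mul (Gen i) (Gen i)) (Gen i)
| hc_braid (i j : 'I_n.-1) : j = i.+1 :> nat ->
    hcong (Mul (Mul (Gen i) (Gen j)) (Gen i)) (Mul (Mul (Gen j) (Gen i)) (Gen j))
| hc_comm (i j : 'I_n.-1) : (i.+1 < j)%N ->
    hcong (Mul (Gen i) (Gen j)) (Mul (Gen j) (Gen i)).

HB.instance Definition _ := gen_eqMixin hterm.
HB.instance Definition _ := gen_choiceMixin hterm.

Definition hrel : rel hterm := fun s t => `[< hcong s t >].

Lemma hrel_refl : reflexive hrel.
Proof. by move=> s; apply/asboolP; exact: hc_refl. Qed.

Lemma hrel_sym : symmetric hrel.
Proof. by move=> s t; apply/asboolP/asboolP; exact: hc_sym. Qed.

Lemma hrel_trans : transitive hrel.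
Proof.
move=> t s u /asboolP st /asboolP tu; apply/asboolP; exact: hc_trans st tu.
Qed.

Canonical hrel_equiv := EquivRel hrel hrel_refl hrel_sym hrel_trans.

Definition H0 : Type := {eq_quot hrel}.
HB.instance Definition _ := Choice.on H0.
HB.instance Definition _ := EqQuotient.on H0.

Definition hclass (s : hterm) : H0 := \pi s.

Lemma hclassP s t : hcong s t <-> hclass s = hclass t.
Proof.
split=> [st|/eqP]; first by apply/eqP; rewrite eqmodE; apply/asboolP.
by rewrite eqmodE => /asboolP.
Qed.

Lemma hrepP s : hcong (hrep (hclass s)) s.
Proof. by apply/hclassP; rewrite /hclass reprK. Qed.

Lemma hclassW (P : H0 -> Prop) : (forall s, P (hclass s)) -> forall x, P x.
Proof. by move=> Ps x; rewrite -[x]reprK; exact: Ps. Qed.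

Definition hadd (x y : H0) := hclass (Add (hrep x) (hrep y)).
Definition hmul (x y : H0) := hclass (Mul (hrep x) (hrep y)).
Definition hopp (x : H0) := hmul (hclass (Scal (-1))) x.

Lemma haddE s t : hadd (hclass s) (hclass t) = hclass (Add s t).
Proof. by apply/hclassP/hc_add; exact: hrepP. Qed.

Lemma hmulE s t : hmul (hclass s) (hclass t) = hclass (Mul s t).
Proof. by apply/hclassP/hc_mul; exact: hrepP. Qed.

Lemma haddA : associative hadd.
Proof.
elim/hclassW=> s; elim/hclassW=> t; elim/hclassW=> u.
by rewrite !haddE; apply/hclassP/hc_addA.
Qed.

Lemma haddC : commutative hadd.
Proof.
by elim/hclassW=> s; elim/hclassW=> t; rewrite !haddE; apply/hclassP/hc_addC.
Qed.

Lemma hadd0 : left_id (hclass (Scal 0)) hadd.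
Proof. by elim/hclassW=> s; rewrite haddE; apply/hclassP/hc_add0. Qed.

Lemma haddN : left_inverse (hclass (Scal 0)) hopp hadd.
Proof.
by elim/hclassW=> s; rewrite /hopp hmulE haddE; apply/hclassP/hc_addN.
Qed.

HB.instance Definition _ := GRing.isZmodule.Build H0 haddA haddC hadd0 haddN.

Lemma hmulA : associative hmul.
Proof.
elim/hclassW=> s; elim/hclassW=> t; elim/hclassW=> u.
by rewrite !hmulE; apply/hclassP/hc_mulA.
Qed.

Lemma hmul1l : left_id (hclass (Scal 1)) hmul.
Proof. by elim/hclassW=> s; rewrite hmulE; apply/hclassP/hc_mul1l. Qed.

Lemma hmul1r : right_id (hclass (Scal 1)) hmul.
Proof. by elim/hclassW=> s; rewrite hmulE; apply/hclassP/hc_mul1r. Qed.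

Lemma hmulDl : left_distributive hmul hadd.
Proof.
elim/hclassW=> s; elim/hclassW=> t; elim/hclassW=> u.
by rewrite !(haddE, hmulE); apply/hclassP/hc_mulDl.
Qed.

Lemma hmulDr : right_distributive hmul hadd.
Proof.
elim/hclassW=> s; elim/hclassW=> t; elim/hclassW=> u.
by rewrite !(haddE, hmulE); apply/hclassP/hc_mulDr.
Qed.

Fixpoint haug (s : hterm) : F :=
  match s with
  | Scal c => c
  | Gen _ => 0
  | Add s t => haug s + haug t
  | Mul s t => haug s * haug t
  end.

Lemma haug_cong s t : hcong s t -> haug s = haug t.
Proof.
elim=> {s t} /=.
- by [].
- by [].
- by move=> s t u _ -> _ ->.
- by move=> s s' t t' _ -> _ ->.
- by move=> s s' t t' _ -> _ ->.
- by move=> *; rewrite addrA.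
- by move=> *; rewrite addrC.
- by move=> *; rewrite add0r.
- by move=> *; rewrite mulN1r addNr.
- by move=> *; rewrite mulrA.
- by move=> *; rewrite mul1r.
- by move=> *; rewrite mulr1.
- by move=> *; rewrite mulrDl.
- by move=> *; rewrite mulrDr.
- by [].
- by [].
- by move=> *; rewrite mulrC.
- by move=> *; rewrite mulr0.
- by move=> *; rewrite !mulr0.
- by move=> *; rewrite !mulr0.
Qed.

Lemma hone_neq0 : hclass (Scal 1) != hclass (Scal 0).
Proof.
by apply/eqP => /hclassP /haug_cong /= /eqP; rewrite oner_eq0.
Qed.

HB.instance Definition _ := GRing.Zmodule_isNzRing.Build H0
  hmulA hmul1l hmul1r hmulDl hmulDr hone_neq0.

Lemma hclassD s t : hclass (Add s t) = hclass s + hclass t.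
Proof. by rewrite -haddE. Qed.

Lemma hclassM s t : hclass (Mul s t) = hclass s * hclass t.
Proof. by rewrite -hmulE. Qed.

Lemma hclass0 : hclass (Scal 0) = 0. Proof. by []. Qed.
Lemma hclass1 : hclass (Scal 1) = 1. Proof. by []. Qed.

Lemma hscalD c d : hclass (Scal (c + d)) = hclass (Scal c) + hclass (Scal d).
Proof. by rewrite -hclassD; apply/hclassP/hc_scalD. Qed.

Lemma hscalM c d : hclass (Scal (c * d)) = hclass (Scal c) * hclass (Scal d).
Proof. by rewrite -hclassM; apply/hclassP/hc_scalM. Qed.

Lemma hscalC c x : hclass (Scal c) * x = x * hclass (Scal c).
Proof.
by elim/hclassW: x => s; rewrite -!hclassM; apply/hclassP/hc_scalC.
Qed.

Definition hscale (c : F) (x : H0) : H0 := hclass (Scal c) * x.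

Lemma hscaleA a b x : hscale a (hscale b x) = hscale (a * b) x.
Proof. by rewrite /hscale hscalM mulrA. Qed.

Lemma hscale1 : left_id 1 hscale.
Proof. exact: mul1r. Qed.

Lemma hscaleDr : right_distributive hscale +%R.
Proof. by move=> c x y; rewrite /hscale mulrDr. Qed.

Lemma hscaleDl x : {morph hscale^~ x : a b / a + b}.
Proof. by move=> a b; rewrite /hscale hscalD mulrDl. Qed.

HB.instance Definition _ := GRing.Zmodule_isLmodule.Build F H0
  hscaleA hscale1 hscaleDr hscaleDl.

Lemma hscaleAl (a : F) (x y : H0) : a *: (x * y) = (a *: x) * y.
Proof. exact: mulrA. Qed.

HB.instance Definition _ := GRing.Lmodule_isLalgebra.Build F H0 hscaleAl.

Lemma hscaleAr (a : F) (x y : H0) : a *: (x * y) = x * (a *: y).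
Proof. by rewrite /GRing.scale /= /hscale mulrA hscalC -!mulrA hscalC. Qed.

HB.instance Definition _ := GRing.Lalgebra_isAlgebra.Build F H0 hscaleAr.

Lemma hclassS c : hclass (Scal c) = c%:A.
Proof. by rewrite /GRing.scale /= /hscale mulr1. Qed.

Definition hpi (i : 'I_n.-1) : H0 := hclass (Gen i).

Definition hecke_relations (A : pzRingType) (q : 'I_n.-1 -> A) : Prop :=
  [/\ forall i, q i * q i = q i,
      forall i j : 'I_n.-1, j = i.+1 :> nat -> q i * q j * q i = q j * q i * q j
    & forall i j : 'I_n.-1, (i.+1 < j)%N -> q i * q j = q j * q i].

Lemma hpi_relations : hecke_relations hpi.
Proof.
split=> [i|i j ij|i j ij].
- by have /hclassP := hc_idem i; rewrite !hclassM.
- by have /hclassP := hc_braid ij; rewrite !hclassM.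
- by have /hclassP := hc_comm ij; rewrite !hclassM.
Qed.

End ZeroHecke.

Arguments hpi F {n} i.

Section Universal.

Variables (F : fieldType) (n : nat) (A : pzRingType) (iota : {rmorphism F -> A}).
Variable q : 'I_n.-1 -> A.
Hypothesis iotaC : forall c x, iota c * x = x * iota c.
Hypothesis q_rel : hecke_relations q.

Fixpoint heval (s : hterm F n) : A :=
  match s with
  | Scal c => iota c
  | Gen i => q i
  | Add s t => heval s + heval t
  | Mul s t => heval s * heval t
  end.

Lemma heval_cong s t : hcong s t -> heval s = heval t.
Proof.
have [q_idem q_braid q_comm] := q_rel.
elim=> {s t} /=.
- by [].
- by [].
- by move=> s t u _ -> _ ->.
- by move=> s s' t t' _ -> _ ->.
- by move=> s s' t t' _ -> _ ->.
- by move=> *; rewrite addrA.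
- by move=> *; rewrite addrC.
- by move=> *; rewrite rmorph0 add0r.
- by move=> *; rewrite rmorphN rmorph1 rmorph0 mulN1r addNr.
- by move=> *; rewrite mulrA.
- by move=> *; rewrite rmorph1 mul1r.
- by move=> *; rewrite rmorph1 mulr1.
- by move=> *; rewrite mulrDl.
- by move=> *; rewrite mulrDr.
- by move=> *; rewrite rmorphD.
- by move=> *; rewrite rmorphM.
- by move=> *; rewrite iotaC.
- exact: q_idem.
- exact: q_braid.
- exact: q_comm.
Qed.

Definition hlift (x : H0 F n) : A := heval (hrep x).

Lemma hliftE s : hlift (hclass s) = heval s.
Proof. exact/heval_cong/hrepP. Qed.

Lemma hlift_pi i : hlift (hpi F i) = q i.
Proof. by rewrite hliftE. Qed.

Lemma hliftD x y : hlift (x + y) = hlift x + hlift y.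
Proof.
by elim/hclassW: x => s; elim/hclassW: y => t; rewrite -hclassD !hliftE.
Qed.

Lemma hliftM x y : hlift (x * y) = hlift x * hlift y.
Proof.
by elim/hclassW: x => s; elim/hclassW: y => t; rewrite -hclassM !hliftE.
Qed.

Lemma hlift_scal c : hlift c%:A = iota c.
Proof. by rewrite -hclassS hliftE. Qed.

Lemma hlift1 : hlift 1 = 1.
Proof. by rewrite -hclass1 hliftE /= rmorph1. Qed.

Lemma hliftZ c x : hlift (c *: x) = iota c * hlift x.
Proof. by rewrite -mulr_algl hliftM hlift_scal. Qed.

End Universal.

Lemma H0_universal (F : fieldType) (n : nat) (A : algType F) (q : 'I_n.-1 -> A) :
  hecke_relations q ->
  exists f : {lrmorphism H0 F n -> A}, (forall i, f (hpi F i) = q i) /\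
    forall g : {lrmorphism H0 F n -> A}, (forall i, g (hpi F i) = q i) -> g =1 f.
Proof.
move=> q_rel.
have AC c (x : A) : in_alg A c * x = x * in_alg A c.
  by rewrite in_algE mulr_algl mulr_algr.
pose f := hlift (in_alg A) q.
have fL : linear f.
  move=> c x y.
  by rewrite /f (hliftD AC q_rel) (hliftZ AC q_rel) /= mulr_algl.
have fM : monoid_morphism f.
  split; [exact: (hlift1 AC q_rel) | exact: (hliftM AC q_rel)].
pose fl := GRing.isLinear.Build _ _ _ _ f fL.
pose fm := GRing.isMonoidMorphism.Build _ _ f fM.
pose F0 : {lrmorphism H0 F n -> A} := HB.pack f fl fm.
exists F0; split=> [i|g gq x]; first exact: (hlift_pi AC q_rel).
rewrite /F0 /= /f; elim/hclassW: x => s; rewrite (hliftE AC q_rel).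
elim: s => [c|i|s IHs t IHt|s IHs t IHt] /=.
- by rewrite hclassS linearZ /= rmorph1.
- exact: gq.
- by rewrite hclassD raddfD /= IHs IHt.
- by rewrite hclassM rmorphM /= IHs IHt.
Qed.

(* The anti-involution: an algebra morphism to the opposite ring H_n(0)^c.      *)
Section Omega.

Variables (F : fieldType) (n : nat).

Definition scal_op (c : F) : (H0 F n)^c := c%:A.

Lemma scal_op_additive : zmod_morphism scal_op.
Proof. by move=> c d; rewrite /scal_op scalerBl. Qed.

Lemma scal_op_monoid : monoid_morphism scal_op.
Proof.
split=> [|c d]; first exact: scale1r.
change ((c * d)%:A = d%:A * c%:A :> H0 F n).
by rewrite mulr_algl scalerA mulrC.
Qed.

HB.instance Definition _ := GRing.isZmodMorphism.Build _ _ scal_op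
  scal_op_additive.
HB.instance Definition _ := GRing.isMonoidMorphism.Build _ _ scal_op
  scal_op_monoid.

Definition omega_gen (i : 'I_n.-1) : (H0 F n)^c :=
  (1 - hpi F (rev_ord i) : H0 F n).

Definition omega : H0 F n -> H0 F n := hlift scal_op omega_gen.

Lemma scal_opC c (x : (H0 F n)^c) : scal_op c * x = x * scal_op c.
Proof.
change ((x : H0 F n) * c%:A = c%:A * (x : H0 F n)).
by rewrite mulr_algl mulr_algr.
Qed.

Lemma omega_gen_relations : hecke_relations omega_gen.
Proof.
have [q_idem q_braid q_comm] := hpi_relations F n.
have braid (a b : H0 F n) : a * a = a -> b * b = b -> a * b * a = b * a * b ->
    (1 - a) * ((1 - b) * (1 - a)) = (1 - b) * ((1 - a) * (1 - b)).
  move=> aa bb aba.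
  have E (x y : H0 F n) : x * x = x ->
      (1 - x) * ((1 - y) * (1 - x)) = 1 - (x + (y - y * x - x * y + x * y * x)).
    move=> xx; rewrite [(1 - y) * _]mulrBl mul1r mulrBr.
    have -> : (1 - x) * (1 - x) = 1 - x.
      by rewrite mulrBl mul1r mulrBr mulr1 xx subrr subr0.
    by rewrite mulrBl mul1r !mulrBr !mulr1 !mulrA !opprD !opprK !addrA.
  rewrite (E a b aa) (E b a bb) aba; congr (1 - _).
  by rewrite [b - _ - _]addrAC !addrA [a + b]addrC.
split=> [i|i j ij|i j ij]; rewrite /omega_gen.
- set a := hpi F _; change ((1 - a) * (1 - a) = 1 - a).
  by rewrite mulrBl mul1r mulrBr mulr1 q_idem subrr subr0.
- set a := hpi F _; set b := hpi F _.
  change ((1 - a) * ((1 - b) * (1 - a)) = (1 - b) * ((1 - a) * (1 - b))).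
  apply: braid; rewrite ?q_idem //; apply/esym/q_braid => /=.
  by rewrite ij -subSn -?ij ?subSS.
- set a := hpi F _; set b := hpi F _.
  change ((1 - b) * (1 - a) = (1 - a) * (1 - b)).
  rewrite !mulrBl !mul1r !mulrBr !mulr1 (_ : b * a = a * b).
    by rewrite !opprB addrCA [RHS]addrCA [1 - a - b]addrAC.
  apply: q_comm => /=; rewrite -subSn; last exact: ltn_ord.
  by rewrite subSS ltn_sub2l // (ltn_trans ij (ltn_ord j)).
Qed.

Lemma omega_pi i : omega (hpi F i) = 1 - hpi F (rev_ord i).
Proof. exact: (hlift_pi scal_opC omega_gen_relations). Qed.

Lemma omegaD x y : omega (x + y) = omega x + omega y.
Proof. exact: (hliftD scal_opC omega_gen_relations). Qed.

Lemma omegaM x y : omega (x * y) = omega y * omega x.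
Proof. exact: (hliftM scal_opC omega_gen_relations). Qed.

Lemma omega1 : omega 1 = 1.
Proof. exact: (hlift1 scal_opC omega_gen_relations). Qed.

Lemma omegaZ c x : omega (c *: x) = c *: omega x.
Proof.
rewrite /omega (hliftZ scal_opC omega_gen_relations).
change ((omega x) * c%:A = c *: omega x); exact: mulr_algr.
Qed.

End Omega.

Definition is_H0_action (F : fieldType) (n : nat) (V : lmodType F)
    (act : H0 F n -> V -> V) : Prop :=
  [/\ forall a, linear (act a),
      forall v, linear (act^~ v),
      forall v, act 1 v = v
    & forall a b v, act (a * b) v = act a (act b v)].

Definition is_H0_isomorphism (F : fieldType) (n : nat) (V W : lmodType F)
    (actV : H0 F n -> V -> V) (actW : H0 F n -> W -> W) (f : V -> W) : Prop :=
  [/\ linear f, bijective f & forall a v, f (actV a v) = actW a (f v)].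

(* omega[M], for M the module given by act; 'Hom(V, F^o) is the dual space.     *)
Definition twisted_dual (F : fieldType) (n : nat) (V : vectType F)
    (act : H0 F n -> V -> V) (a : H0 F n) (d : 'Hom(V, F^o)) : 'Hom(V, F^o) :=
  linfun (fun v => d (act (omega a) v)).

Lemma twisted_dualE (F : fieldType) (n : nat) (V : vectType F)
    (act : H0 F n -> V -> V) a (d : 'Hom(V, F^o)) v :
  is_H0_action act -> twisted_dual act a d v = d (act (omega a) v).
Proof.
case=> actL _ _ _; pose g v := d (act (omega a) v).
have gL : linear g by move=> c u w; rewrite /g actL linearP.
pose gl : {linear V -> F^o} := HB.pack g (GRing.isLinear.Build _ _ _ _ g gL).
by rewrite /twisted_dual -/g (lfunE gl).
Qed.

Lemma twisted_dual_action (F : fieldType) (n : nat) (V : vectType F)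
    (act : H0 F n -> V -> V) : is_H0_action act -> is_H0_action (twisted_dual act).
Proof.
move=> actP; have [actL actLl act1 actM] := actP.
split=> [a c d e|d c a b|d|a b d]; apply/lfunP => v.
- by rewrite !(twisted_dualE, add_lfunE, scale_lfunE).
- rewrite !(twisted_dualE, add_lfunE, scale_lfunE) // omegaD omegaZ.
  by rewrite actLl linearP.
- by rewrite twisted_dualE // omega1 act1.
- by rewrite !twisted_dualE // omegaM actM.
Qed.

Section ActionFromGenerators.

Variables (F : fieldType) (n : nat) (V : lmodType F) (q : 'I_n.-1 -> V -> V).
Hypothesis qL : forall i, linear (q i).
Hypothesis q_idem : forall i v, q i (q i v) = q i v.
Hypothesis q_braid : forall (i j : 'I_n.-1) v, j = i.+1 :> nat ->
  q i (q j (q i v)) = q j (q i (q j v)).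
Hypothesis q_comm : forall (i j : 'I_n.-1) v, (i.+1 < j)%N ->
  q i (q j v) = q j (q i v).

Fixpoint tact (s : hterm F n) (v : V) : V :=
  match s with
  | Scal c => c *: v
  | Gen i => q i v
  | Add s t => tact s v + tact t v
  | Mul s t => tact s (tact t v)
  end.

Definition hact (x : H0 F n) : V -> V := tact (hrep x).

Lemma tactL s : linear (tact s).
Proof.
elim: s => [c|i|s IHs t IHt|s IHs t IHt] d u v /=.
- by rewrite scalerDr !scalerA mulrC.
- exact: qL.
- by rewrite IHs IHt scalerDr addrACA.
- by rewrite IHt IHs.
Qed.

Lemma tactD s u v : tact s (u + v) = tact s u + tact s v.
Proof. by rewrite -[u]scale1r tactL !scale1r. Qed.

Lemma tact0 s : tact s 0 = 0.
Proof. by apply: (addrI (tact s 0)); rewrite -tactD !addr0. Qed.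

Lemma tactZ s c v : tact s (c *: v) = c *: tact s v.
Proof. by rewrite -[c *: v]addr0 tactL tact0 addr0. Qed.

Lemma tact_cong s t : hcong s t -> forall v, tact s v = tact t v.
Proof.
elim=> {s t} /=.
- by [].
- by move=> s t _ st v; rewrite st.
- by move=> s t u _ st _ tu v; rewrite st tu.
- by move=> s s' t t' _ ss _ tt v; rewrite ss tt.
- by move=> s s' t t' _ ss _ tt v; rewrite ss tt.
- by move=> *; rewrite addrA.
- by move=> *; rewrite addrC.
- by move=> *; rewrite scale0r add0r.
- by move=> *; rewrite scaleN1r scale0r addNr.
- by [].
- by move=> *; rewrite scale1r.
- by move=> *; rewrite scale1r.
- by [].
- by move=> *; rewrite tactD.
- by move=> *; rewrite scalerDl.
- by move=> *; rewrite scalerA.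
- by move=> *; rewrite tactZ.
- by move=> *; exact: q_idem.
- by move=> *; exact: q_braid.
- by move=> *; exact: q_comm.
Qed.

Lemma hactE s v : hact (hclass s) v = tact s v.
Proof. exact/tact_cong/hrepP. Qed.

Lemma hact_pi i v : hact (hpi F i) v = q i v.
Proof. exact: hactE. Qed.

Lemma hact_action : is_H0_action hact.
Proof.
split.
- by move=> a; exact: tactL.
- move=> v c; elim/hclassW=> s; elim/hclassW=> t.
  by rewrite -mulr_algl -hclassS -hclassM -hclassD !hactE.
- by move=> v; rewrite -hclass1 hactE /= scale1r.
- elim/hclassW=> s; elim/hclassW=> t v.
  by rewrite -hclassM !hactE.
Qed.

End ActionFromGenerators.

Section SymmetricGroup.

Variable n : nat.

Lemma hi_subproof (i : 'I_n.-1) : (i.+1 < n)%N.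
Proof. by rewrite -ltn_predRL. Qed.

Definition lo (i : 'I_n.-1) : 'I_n := widen_ord (leq_pred n) i.
Definition hi (i : 'I_n.-1) : 'I_n := Ordinal (hi_subproof i).

Definition stransp (i : 'I_n.-1) : 'S_n := tperm (lo i) (hi i).

(* s_(i1) o ... o s_(ip) for w = i1 ... ip; MathComp composes permutations from *)
(* left to right, hence the rev.                                                *)
Definition word_perm (w : seq 'I_n.-1) : 'S_n := (\prod_(i <- rev w) stransp i)%g.

Lemma word_perm_cat u v : word_perm (u ++ v) = (word_perm v * word_perm u)%g.
Proof. by rewrite /word_perm rev_cat big_cat. Qed.

Lemma word_perm1 i : word_perm [:: i] = stransp i.
Proof. by rewrite /word_perm /rev /= big_seq1. Qed.

Lemma tperm_word d (x y : 'I_n) : y = (x + d).+1 :> nat ->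
  exists w, word_perm w = tperm x y.
Proof.
elim: d y => [|d IHd] y yE.
  have xn : (x < n.-1)%N by rewrite ltn_predRL -[x : nat]addn0 -yE.
  exists [:: Ordinal xn]; rewrite word_perm1 /stransp.
  by congr tperm; apply: val_inj => //=; rewrite yE addn0.
have zn : ((x + d).+1 < n)%N by rewrite -addnS ltnW // -yE.
pose z := Ordinal zn.
have [w wE] := IHd z erefl.
have yn : ((x + d).+1 < n.-1)%N by rewrite ltn_predRL -addnS -yE.
have sE : stransp (Ordinal yn) = tperm z y.
  by rewrite /stransp; congr tperm; apply: val_inj => //=; rewrite yE addnS.
exists ([:: Ordinal yn] ++ w ++ [:: Ordinal yn]).
rewrite !word_perm_cat wE word_perm1 sE -{1}[tperm z y]tpermV -mulgA.
rewrite -[RHS](_ : (tperm x z ^ tperm z y)%g = _) // tpermJ tpermL tpermD //.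
- by rewrite -val_eqE /= gtn_eqF // ltnS leq_addr.
- by rewrite -val_eqE /= yE gtn_eqF // ltnS leq_addr.
Qed.

Lemma word_perm_surj (g : 'S_n) : exists w, word_perm w = g.
Proof.
have [ts -> _] := prod_tpermP g; elim: ts => [|[x y] ts [w IHw]].
  by exists [::]; rewrite /word_perm !big_nil.
have [u uE] : exists u, word_perm u = tperm x y.
  have [xy|yx|xy] := ltngtP x y.
  - by apply: (@tperm_word (y - x.+1)%N); rewrite -addSn subnKC.
  - by rewrite tpermC; apply: (@tperm_word (x - y.+1)%N); rewrite -addSn subnKC.
  - by exists [::]; rewrite (val_inj xy) tperm1 /word_perm big_nil.
by exists (w ++ u); rewrite word_perm_cat big_cons uE IHw.
Qed.

Lemma expression_exists (g : 'S_n) :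
  exists m, [exists w : m.-tuple 'I_n.-1, word_perm w == g].
Proof.
have [w <-] := word_perm_surj g; exists (size w).
by apply/existsP; exists (in_tuple w).
Qed.

Definition coxlen (g : 'S_n) : nat := ex_minn (expression_exists g).

Lemma reduced_exists (g : 'S_n) :
  exists w : (coxlen g).-tuple 'I_n.-1, word_perm w == g.
Proof. by rewrite /coxlen; case: ex_minnP => m /existsP. Qed.

Definition reduced (g : 'S_n) : (coxlen g).-tuple 'I_n.-1 :=
  xchoose (reduced_exists g).

Lemma reducedP g : word_perm (reduced g) = g.
Proof. exact/eqP/(xchooseP (reduced_exists g)). Qed.

Lemma coxlen_min w : (coxlen (word_perm w) <= size w)%N.
Proof.
rewrite /coxlen; case: ex_minnP => m _; apply.
by apply/existsP; exists (in_tuple w).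
Qed.

(* By Matsumoto's theorem the choice of the reduced expression is immaterial.   *)
Definition hpi_perm (F : fieldType) (g : 'S_n) : H0 F n :=
  \prod_(i <- reduced g) hpi F i.

Definition w0 : 'S_n := perm (@rev_ord_inj n).

Definition w0conj (s : 'S_n) : 'S_n := (w0 * s * w0)%g.

End SymmetricGroup.

Record composition (n k : nat) := Composition {
  parts :> k.-tuple nat;
  partsP : all (ltn 0) parts && (sumn parts == n)
}.

Lemma rev_composition_subproof n k (a : composition n k) :
  all (ltn 0) (rev_tuple a) && (sumn (rev_tuple a) == n).
Proof. by rewrite all_rev sumn_rev partsP. Qed.

Definition rev_composition n k (a : composition n k) : composition n k :=
  Composition (rev_composition_subproof a).

Section Fillings.

Variables (n k : nat) (b : composition n k).

(* The boxes (i, j), 0 <= j < b_i, of the composition diagram of b. *)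
Definition box : finType := {i : 'I_k & 'I_(tnth b i)}.
Definition box_row (x : box) : 'I_k := tag x.
Definition box_col (x : box) : nat := tagged x.

Lemma part_gt0 (i : 'I_k) : (0 < tnth b i)%N.
Proof. by have /andP[/all_tnthP + _] := partsP b; exact. Qed.

Definition first_box (i : 'I_k) : box :=
  Tagged (fun i => 'I_(tnth b i)) (Ordinal (part_gt0 i)).

Lemma card_box : #|box| = n.
Proof.
rewrite card_tagged (_ : map _ _ = b); first by case/andP: (partsP b) => _ /eqP.
rewrite -[RHS](map_tnth_enum b); apply: eq_map => i; exact: card_ord.
Qed.

Definition filling := {ffun box -> 'I_n}.

Definition swap (i : 'I_n.-1) (T : filling) : filling :=
  [ffun x => stransp i (T x)].

(* In the relations r below, x is the box of i and y the box of i + 1.          *)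
Definition next_at (T : filling) (i : 'I_n.-1) (r : rel box) : bool :=
  [exists x, exists y, [&& T x == lo i, T y == hi i & r x y]].

Definition strictly_left : rel box := fun x y => (box_col y < box_col x)%N.
Definition weakly_left : rel box := fun x y => (box_col y <= box_col x)%N.
Definition right_adjacent : rel box :=
  fun x y => (box_row y == box_row x) && (box_col y == (box_col x).+1).
Definition attacking : rel box := fun x y =>
  (box_col y == box_col x) || ((box_col y == (box_col x).+1) && (box_row x < box_row y)%N).

End Fillings.

(* The one-line notation of the standardization of a word with distinct letters.*)
Definition standardization (n k : nat) (w : 'I_k -> 'I_n) (i : 'I_k) : nat :=
  #|[set j | (w j < w i)%N]|.

Definition is_SPYRT n k (a : composition n k) (s : 'S_k)
    (T : filling (rev_composition a)) : bool :=
  [&& injectiveb T,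
      [forall i, standardization
                   (fun j => T (first_box (rev_composition a) (rev_ord j))) i
                 == s i],
      [forall x, forall y,
         (box_row x == box_row y) && (box_col x < box_col y)%N ==> (T x < T y)%N]
    & [forall x, forall y,
         [&& (box_row x < box_row y)%N, box_col y == (box_col x).+1 & (T x < T y)%N] ==>
         [exists z, [&& box_row z == box_row x, box_col z == box_col y & (T z < T y)%N]]]].

Definition is_SPCT n k (b : composition n k) (u : 'S_k) (T : filling b) : bool :=
  [&& injectiveb T,
      [forall i, standardization (fun j => T (first_box b j)) i == u i],
      [forall x, forall y,
         (box_row x == box_row y) && (box_col x < box_col y)%N ==> (T y < T x)%N]
    & [forall x, forall y,
         [&& (box_row x < box_row y)%N, box_col y == (box_col x).+1 & (T y < T x)%N] ==>
         [exists z, [&& box_row z == box_row x, box_col z == box_col y & (T y < T z)%N]]]].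

Definition SPYRT n k (a : composition n k) (s : 'S_k) : finType :=
  {T : filling (rev_composition a) | is_SPYRT s T}.

Definition SPCT n k (b : composition n k) (u : 'S_k) : finType :=
  {T : filling b | is_SPCT u T}.

Definition freemod (F : fieldType) (I : finType) : vectType F := {ffun I -> F^o}.

Definition basis_vect (F : fieldType) (I : finType) (x : I) : freemod F I :=
  [ffun y => (y == x)%:R].

Definition dual_vect (F : fieldType) (I : finType) (x : I) :
    'Hom(freemod F I, F^o) :=
  linfun (fun v : freemod F I => v x : F^o).

Lemma dual_vectE (F : fieldType) (I : finType) (x : I) (v : freemod F I) :
  dual_vect F x v = v x.
Proof.
pose g (v : freemod F I) : F^o := v x.
have gL : linear g by move=> c w1 w2; rewrite /g !ffunE.
pose gl : {linear freemod F I -> F^o} :=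
  HB.pack g (GRing.isLinear.Build _ _ _ _ g gL).
by rewrite /dual_vect (lfunE gl).
Qed.

Section SModule.

Variables (F : fieldType) (n k : nat) (b : composition n k) (u : 'S_k).
Implicit Type T : SPCT b u.

Local Notation e T := (basis_vect F T).

(* The default T of insubd is never used in Sbasis: see SPCT_swapE.             *)
Definition SPCT_swap (i : 'I_n.-1) T : SPCT b u := insubd T (swap i (val T)).

Definition Sbasis (i : 'I_n.-1) T : freemod F (SPCT b u) :=
  if next_at (val T) i (@strictly_left n k b) then e T
  else if next_at (val T) i (@attacking n k b) then 0
  else e (SPCT_swap i T).

Definition Sgen (i : 'I_n.-1) (v : freemod F (SPCT b u)) : freemod F (SPCT b u) :=
  \sum_(T : SPCT b u) v T *: Sbasis i T.

Lemma next_atE (T : filling b) i r x y : injective T ->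
  T x = lo i -> T y = hi i -> next_at T i r = r x y.
Proof.
move=> Tinj Tx Ty; apply/existsP/idP => [[x' /existsP[y']]|rxy].
  case/and3P=> /eqP Tx' /eqP Ty'.
  by rewrite (Tinj x' x) ?Tx // (Tinj y' y) ?Ty.
by exists x; apply/existsP; exists y; rewrite Tx Ty !eqxx.
Qed.

Lemma SPCT_inj T : injective (val T).
Proof. by case: T => T /= /and4P[/injectiveP]. Qed.

Lemma filling_surj (T : filling b) : injective T -> forall c, exists x, T x = c.
Proof.
move=> Tinj c; have /codomP[x ->] : c \in codom T; last by exists x.
by apply: inj_card_onto => //; rewrite card_box card_ord.
Qed.

Lemma stransp_lt (i : 'I_n.-1) (c d : 'I_n) :
  ~ (c = lo i /\ d = hi i) -> ~ (c = hi i /\ d = lo i) ->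
  (stransp i c < stransp i d)%N = (c < d)%N.
Proof.
move=> h1 h2; rewrite /stransp.
have vlo : lo i = i :> nat by [].
have vhi : hi i = i.+1 :> nat by [].
have ne (x y : 'I_n) : x <> y -> x <> y :> nat by move=> ? /val_inj.
case: (tpermP (lo i) (hi i) c) => [cE|cE|/ne c1 /ne c2];
  case: (tpermP (lo i) (hi i) d) => [dE|dE|/ne d1 /ne d2]; subst.
all: try by [case: h1 | case: h2 | rewrite ?ltnn].
all: lia.
Qed.

Lemma swap_SPCT (i : 'I_n.-1) T x y : val T x = lo i -> val T y = hi i ->
  (box_col x < box_col y)%N -> ~~ attacking x y -> is_SPCT u (swap i (val T)).
Proof.
case: T => T /= TP Tx Ty xy natt; have /and4P[/injectiveP Tinj T1 T2 T3] := TP.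
have ltE p q : ~ (p = x /\ q = y) -> ~ (p = y /\ q = x) ->
    (swap i T p < swap i T q)%N = (T p < T q)%N.
  move=> h1 h2; rewrite !ffunE; apply: stransp_lt => -[pE qE].
    by apply: h1; split; apply: Tinj; rewrite ?Tx ?Ty.
  by apply: h2; split; apply: Tinj; rewrite ?Tx ?Ty.
have same_col p q : box_col p = box_col q -> (swap i T p < swap i T q)%N = (T p < T q)%N.
  by move=> pq; apply: ltE => -[pE qE]; subst; rewrite pq ltnn in xy.
apply/and4P; split.
- by apply/injectiveP => p q; rewrite !ffunE => /perm_inj /Tinj.
- apply/forallP => l; rewrite -(eqP (forallP T1 l)) /standardization.
  by apply/eqP/eq_card => m; rewrite !inE same_col.
- apply/forallP => p; apply/forallP => q; apply/implyP => pq.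
  have Tqp := implyP (forallP (forallP T2 p) q) pq.
  case/andP: pq => _ pq; rewrite ltE // => -[pE qE]; subst; last first.
    by rewrite Tx Ty /= ltnNge leqnSn in Tqp.
  by move: (ltn_trans xy pq); rewrite ltnn.
- apply/forallP => p; apply/forallP => q; apply/implyP => /and3P[rpq cpq].
  rewrite ltE; first last.
  + by case=> ? ?; subst; rewrite /attacking cpq rpq orbT in natt.
  + by case=> ? ?; subst; rewrite (eqP cpq) ltnNge leqnSn in xy.
  move=> Tqp; have /existsP[z /and3P[rz cz Tz]] :=
    implyP (forallP (forallP T3 p) q) (introT and3P (And3 rpq cpq Tqp)).
  by apply/existsP; exists z; rewrite rz cz same_col ?Tz //= (eqP cz).
Qed.

Lemma SPCT_swapE (i : 'I_n.-1) T x y : val T x = lo i -> val T y = hi i ->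
  (box_col x < box_col y)%N -> ~~ attacking x y -> val (SPCT_swap i T) = swap i (val T).
Proof. by move=> Tx Ty xy natt; rewrite insubdK //; exact: swap_SPCT xy natt. Qed.

Lemma Sgen_linear i : linear (Sgen i).
Proof.
move=> c v w; rewrite /Sgen scaler_sumr -big_split; apply: eq_bigr => T _ /=.
by rewrite !ffunE scalerDl scalerA.
Qed.

Lemma Sgen_basis i T : Sgen i (e T) = Sbasis i T.
Proof.
rewrite /Sgen (bigD1 T) //= ffunE eqxx scale1r big1 ?addr0 // => T' TT'.
by rewrite ffunE (negPf TT') scale0r.
Qed.

Lemma SgenL i T x y : val T x = lo i -> val T y = hi i ->
  (box_col y < box_col x)%N -> Sgen i (e T) = e T.
Proof.
move=> Tx Ty yx.
by rewrite Sgen_basis /Sbasis (next_atE _ (@SPCT_inj T) Tx Ty) /strictly_left yx.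
Qed.

Lemma SgenZ i T x y : val T x = lo i -> val T y = hi i ->
  attacking x y -> Sgen i (e T) = 0.
Proof.
move=> Tx Ty xy.
rewrite Sgen_basis /Sbasis !(next_atE _ (@SPCT_inj T) Tx Ty) xy /strictly_left.
by case: ltnP => // yx; move: xy; rewrite /attacking; lia.
Qed.

Lemma SgenS i T x y : val T x = lo i -> val T y = hi i ->
  (box_col x < box_col y)%N -> ~~ attacking x y -> Sgen i (e T) = e (SPCT_swap i T).
Proof.
move=> Tx Ty xy /negPf natt.
rewrite Sgen_basis /Sbasis !(next_atE _ (@SPCT_inj T) Tx Ty) natt /strictly_left.
by rewrite ltnNge (ltnW xy).
Qed.

Lemma box_cases (x y : box b) :
  [\/ (box_col y < box_col x)%N, attacking x y | (box_col x < box_col y)%N /\ ~~ attacking x y].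
Proof.
have [xy|yx|xy] := ltngtP (box_col x) (box_col y).
- by have [att|natt] := boolP (attacking x y); [exact: Or32 | exact: Or33].
- exact: Or31.
- by apply: Or32; rewrite /attacking xy eqxx.
Qed.

Lemma Sgen0 i : Sgen i 0 = 0.
Proof. by rewrite /Sgen big1 // => T _; rewrite ffunE scale0r. Qed.

Lemma linear_ext (V : lmodType F) (f g : freemod F (SPCT b u) -> V) :
  linear f -> linear g -> (forall T, f (e T) = g (e T)) -> f =1 g.
Proof.
move=> fL gL fg v.
pose fl : {linear _ -> V} := HB.pack f (GRing.isLinear.Build _ _ _ _ f fL).
pose gl : {linear _ -> V} := HB.pack g (GRing.isLinear.Build _ _ _ _ g gL).
have -> : v = \sum_T v T *: e T.
  apply/ffunP => T; rewrite sum_ffunE (bigD1 T) //= big1 ?addr0.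
    by rewrite !ffunE eqxx; exact/esym/mulr1.
  by move=> T' TT'; rewrite !ffunE eq_sym (negPf TT') scaler0.
rewrite -[f _]/(fl _) -[g _]/(gl _) !linear_sum; apply: eq_bigr => T _.
by rewrite !linearZ /= fg.
Qed.

Lemma comp_linear (f g : freemod F (SPCT b u) -> freemod F (SPCT b u)) :
  linear f -> linear g -> linear (f \o g).
Proof. by move=> fL gL c v w; rewrite /= gL fL. Qed.

Lemma Sgen_idem i v : Sgen i (Sgen i v) = Sgen i v.
Proof.
apply: (linear_ext (f := Sgen i \o Sgen i)) v => [||T].
- by apply: comp_linear; exact: Sgen_linear.
- exact: Sgen_linear.
have [x Tx] := filling_surj (@SPCT_inj T) (lo i).
have [y Ty] := filling_surj (@SPCT_inj T) (hi i).
rewrite /=; case: (box_cases x y) => [xy|xy|[xy nxy]].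
- by rewrite !(SgenL Tx Ty xy).
- by rewrite (SgenZ Tx Ty xy) Sgen0.
rewrite (SgenS Tx Ty xy nxy); have sE := SPCT_swapE Tx Ty xy nxy.
by apply: (SgenL (x := y) (y := x)) => //; rewrite sE ffunE ?Tx ?Ty ?tpermL ?tpermR.
Qed.

Lemma Sgen_comm (i j : 'I_n.-1) v : (i.+1 < j)%N ->
  Sgen i (Sgen j v) = Sgen j (Sgen i v).
Proof.
move=> ij.
apply: (linear_ext (f := Sgen i \o Sgen j) (g := Sgen j \o Sgen i)) v => [||T].
- by apply: comp_linear; exact: Sgen_linear.
- by apply: comp_linear; exact: Sgen_linear.
have [x Tx] := filling_surj (@SPCT_inj T) (lo i).
have [y Ty] := filling_surj (@SPCT_inj T) (hi i).
have [z Tz] := filling_surj (@SPCT_inj T) (lo j).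
have [t Tt] := filling_surj (@SPCT_inj T) (hi j).
have jlo : stransp j (lo i) = lo i by rewrite /stransp tpermD // -val_eqE /=; lia.
have jhi : stransp j (hi i) = hi i by rewrite /stransp tpermD // -val_eqE /=; lia.
have ilo : stransp i (lo j) = lo j by rewrite /stransp tpermD // -val_eqE /=; lia.
have ihi : stransp i (hi j) = hi j by rewrite /stransp tpermD // -val_eqE /=; lia.
rewrite /=; case: (box_cases x y) => [xy|xy|[xy nxy]];
  case: (box_cases z t) => [zt|zt|[zt nzt]].
- by rewrite (SgenL Tx Ty xy) (SgenL Tz Tt zt) (SgenL Tx Ty xy).
- by rewrite (SgenL Tx Ty xy) (SgenZ Tz Tt zt) Sgen0.
- rewrite (SgenL Tx Ty xy) (SgenS Tz Tt zt nzt).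
  have sE := SPCT_swapE Tz Tt zt nzt.
  by apply: SgenL xy; rewrite sE ffunE ?Tx ?Ty.
- by rewrite (SgenZ Tx Ty xy) (SgenL Tz Tt zt) (SgenZ Tx Ty xy) Sgen0.
- by rewrite (SgenZ Tx Ty xy) (SgenZ Tz Tt zt) !Sgen0.
- rewrite (SgenZ Tx Ty xy) (SgenS Tz Tt zt nzt) Sgen0.
  have sE := SPCT_swapE Tz Tt zt nzt.
  by apply: SgenZ xy; rewrite sE ffunE ?Tx ?Ty.
- rewrite (SgenL Tz Tt zt) (SgenS Tx Ty xy nxy).
  have sE := SPCT_swapE Tx Ty xy nxy.
  by apply/esym; apply: SgenL zt; rewrite sE ffunE ?Tz ?Tt.
- rewrite (SgenZ Tz Tt zt) (SgenS Tx Ty xy nxy) Sgen0.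
  have sE := SPCT_swapE Tx Ty xy nxy.
  by apply/esym; apply: SgenZ zt; rewrite sE ffunE ?Tz ?Tt.
rewrite (SgenS Tx Ty xy nxy) (SgenS Tz Tt zt nzt).
have sE := SPCT_swapE Tx Ty xy nxy; have sE' := SPCT_swapE Tz Tt zt nzt.
have Tx' : val (SPCT_swap j T) x = lo i by rewrite sE' ffunE Tx.
have Ty' : val (SPCT_swap j T) y = hi i by rewrite sE' ffunE Ty.
have Tz' : val (SPCT_swap i T) z = lo j by rewrite sE ffunE Tz.
have Tt' : val (SPCT_swap i T) t = hi j by rewrite sE ffunE Tt.
rewrite (SgenS Tx' Ty' xy nxy) (SgenS Tz' Tt' zt nzt); congr (e _).
apply: val_inj; rewrite (SPCT_swapE Tx' Ty' xy nxy) (SPCT_swapE Tz' Tt' zt nzt).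
apply/ffunP => w; rewrite sE sE' !ffunE -!permM; congr (fun_of_perm _ _).
by apply/esym/commgP/conjg_fixP; rewrite tpermJ -/(stransp j) jlo jhi.
Qed.

Lemma Sgen_braid (i j : 'I_n.-1) v : j = i.+1 :> nat ->
  Sgen i (Sgen j (Sgen i v)) = Sgen j (Sgen i (Sgen j v)).
Proof.
move=> ij; have hl : hi i = lo j by apply: val_inj; rewrite /= ij.
apply: (linear_ext (f := Sgen i \o (Sgen j \o Sgen i))
                   (g := Sgen j \o (Sgen i \o Sgen j))) v => [||T].
- by do 2?apply: comp_linear; exact: Sgen_linear.
- by do 2?apply: comp_linear; exact: Sgen_linear.
pose pos T x y z := [/\ val T x = lo i, val T y = hi i & val T z = hi j].
have jlo : stransp j (lo i) = lo i by rewrite /stransp tpermD // -val_eqE /=; lia.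
have ihi : stransp i (hi j) = hi j by rewrite /stransp tpermD // -val_eqE /=; lia.
have iL U x y z : pos U x y z -> (box_col y < box_col x)%N -> Sgen i (e U) = e U.
  by case=> Ux Uy _; exact: SgenL.
have iZ U x y z : pos U x y z -> attacking x y -> Sgen i (e U) = 0.
  by case=> Ux Uy _; exact: SgenZ.
have iS U x y z : pos U x y z -> (box_col x < box_col y)%N -> ~~ attacking x y ->
    Sgen i (e U) = e (SPCT_swap i U).
  by case=> Ux Uy _; exact: SgenS.
have iP U x y z : pos U x y z -> (box_col x < box_col y)%N -> ~~ attacking x y ->
    pos (SPCT_swap i U) y x z.
  case=> Ux Uy Uz xy nxy; rewrite /pos (SPCT_swapE Ux Uy xy nxy) !ffunE Ux Uy Uz.
  by rewrite tpermL tpermR.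
have jL U x y z : pos U x y z -> (box_col z < box_col y)%N -> Sgen j (e U) = e U.
  by case=> _; rewrite hl => Uy Uz; exact: SgenL.
have jZ U x y z : pos U x y z -> attacking y z -> Sgen j (e U) = 0.
  by case=> _; rewrite hl => Uy Uz; exact: SgenZ.
have jS U x y z : pos U x y z -> (box_col y < box_col z)%N -> ~~ attacking y z ->
    Sgen j (e U) = e (SPCT_swap j U).
  by case=> _; rewrite hl => Uy Uz; exact: SgenS.
have jP U x y z : pos U x y z -> (box_col y < box_col z)%N -> ~~ attacking y z ->
    pos (SPCT_swap j U) x z y.
  case=> Ux; rewrite /pos hl => Uy Uz yz nyz.
  by rewrite (SPCT_swapE Uy Uz yz nyz) !ffunE Ux Uy Uz jlo tpermL tpermR.
have [p Tp] := filling_surj (@SPCT_inj T) (lo i).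
have [q Tq] := filling_surj (@SPCT_inj T) (hi i).
have [r Tr] := filling_surj (@SPCT_inj T) (hi j).
have t : pos T p q r by [].
rewrite /=; case: (box_cases p q) => [pq|pq|[pq npq]];
  case: (box_cases q r) => [qr|qr|[qr nqr]].
- by rewrite !(iL _ _ _ _ t pq, jL _ _ _ _ t qr).
- by rewrite !(iL _ _ _ _ t pq, jZ _ _ _ _ t qr, Sgen0).
- rewrite (iL _ _ _ _ t pq) (jS _ _ _ _ t qr nqr).
  have t1 := jP _ _ _ _ t qr nqr.
  case: (box_cases p r) => [pr|pr|[pr npr]].
  + by rewrite (iL _ _ _ _ t1 pr) (jL _ _ _ _ t1 qr).
  + by rewrite (iZ _ _ _ _ t1 pr) Sgen0.
  + rewrite (iS _ _ _ _ t1 pr npr); have t2 := iP _ _ _ _ t1 pr npr.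
    by rewrite (jL _ _ _ _ t2 pq).
- by rewrite (iZ _ _ _ _ t pq) (jL _ _ _ _ t qr) (iZ _ _ _ _ t pq) !Sgen0.
- by rewrite (iZ _ _ _ _ t pq) (jZ _ _ _ _ t qr) !Sgen0.
- rewrite (iZ _ _ _ _ t pq) !Sgen0 (jS _ _ _ _ t qr nqr).
  have t1 := jP _ _ _ _ t qr nqr.
  case: (box_cases p r) => [pr|pr|[pr npr]].
  + by move: pq pr qr; rewrite /attacking; lia.
  + by rewrite (iZ _ _ _ _ t1 pr) Sgen0.
  + rewrite (iS _ _ _ _ t1 pr npr); have t2 := iP _ _ _ _ t1 pr npr.
    by rewrite (jZ _ _ _ _ t2 pq).
- rewrite (jL _ _ _ _ t qr) (iS _ _ _ _ t pq npq).
  have t1 := iP _ _ _ _ t pq npq.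
  case: (box_cases p r) => [pr|pr|[pr npr]].
  + by rewrite (jL _ _ _ _ t1 pr) (iL _ _ _ _ t1 pq).
  + by rewrite (jZ _ _ _ _ t1 pr) Sgen0.
  + rewrite (jS _ _ _ _ t1 pr npr); have t2 := jP _ _ _ _ t1 pr npr.
    by rewrite (iL _ _ _ _ t2 qr).
- rewrite (jZ _ _ _ _ t qr) !Sgen0 (iS _ _ _ _ t pq npq).
  have t1 := iP _ _ _ _ t pq npq.
  case: (box_cases p r) => [pr|pr|[pr npr]].
  + by move: pq pr qr; rewrite /attacking; lia.
  + by rewrite (jZ _ _ _ _ t1 pr) Sgen0.
  + rewrite (jS _ _ _ _ t1 pr npr); have t2 := jP _ _ _ _ t1 pr npr.
    by rewrite (iZ _ _ _ _ t2 qr).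
have pr : (box_col p < box_col r)%N by lia.
have npr : ~~ attacking p r by rewrite /attacking; lia.
have t1 := iP _ _ _ _ t pq npq; have t2 := jP _ _ _ _ t1 pr npr.
have u1 := jP _ _ _ _ t qr nqr; have u2 := iP _ _ _ _ u1 pr npr.
rewrite (iS _ _ _ _ t pq npq) (jS _ _ _ _ t1 pr npr) (iS _ _ _ _ t2 qr nqr).
rewrite (jS _ _ _ _ t qr nqr) (iS _ _ _ _ u1 pr npr) (jS _ _ _ _ u2 pq npq).
congr (e _); apply: val_inj.
have iV U x y z : pos U x y z -> (box_col x < box_col y)%N -> ~~ attacking x y ->
    val (SPCT_swap i U) = swap i (val U).
  by case=> Ux Uy _; exact: SPCT_swapE.
have jV U x y z : pos U x y z -> (box_col y < box_col z)%N -> ~~ attacking y z ->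
    val (SPCT_swap j U) = swap j (val U).
  by case=> _; rewrite hl => Uy Uz; exact: SPCT_swapE.
rewrite (iV _ _ _ _ t2 qr nqr) (jV _ _ _ _ t1 pr npr) (iV _ _ _ _ t pq npq).
rewrite (jV _ _ _ _ u2 pq npq) (iV _ _ _ _ u1 pr npr) (jV _ _ _ _ t qr nqr).
apply/ffunP => w; rewrite !ffunE -!permM; congr (fun_of_perm _ _).
have iVi : (stransp i)^-1%g = stransp i by exact: tpermV.
have jVj : (stransp j)^-1%g = stransp j by exact: tpermV.
transitivity (stransp j ^ stransp i)%g; first by rewrite conjgE iVi mulgA.
transitivity (stransp i ^ stransp j)%g; last by rewrite conjgE jVj mulgA.
by rewrite !tpermJ -/(stransp i) -/(stransp j) jlo ihi -hl tpermR hl tpermL.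
Qed.

Definition Sact : H0 F n -> freemod F (SPCT b u) -> freemod F (SPCT b u) :=
  hact Sgen.

Lemma Sact_action : is_H0_action Sact.
Proof. exact: hact_action Sgen_linear Sgen_idem Sgen_braid Sgen_comm. Qed.

Lemma Sact_pi i T : Sact (hpi F i) (e T) = Sbasis i T.
Proof.
rewrite -Sgen_basis.
exact: (hact_pi Sgen_linear Sgen_idem Sgen_braid Sgen_comm).
Qed.

End SModule.

Section Rank.

Variables (F : fieldType) (n k : nat) (b : composition n k) (u : 'S_k).
Implicit Types t : SPCT b u.

Definition equivalent t1 t2 : bool :=
  [forall x, forall y, (box_col x == box_col y) ==>
     ((val t1 x < val t1 y)%N == (val t2 x < val t2 y)%N)].

(* pi_g . t1 = t2 *)
Definition carries (g : 'S_n) t1 t2 : bool :=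
  Sact (hpi_perm F g) (basis_vect F t1) == basis_vect F t2.

Definition is_source t0 : bool :=
  [forall t, equivalent t t0 ==> [exists g, carries g t0 t]].

(* Every class has a (unique) source, so that the default t is not used.        *)
Definition source t : SPCT b u :=
  odflt t [pick t0 | equivalent t0 t && is_source t0].

(* Some g carries the source to t, so that the default 1 is not used.           *)
Definition rank t : nat :=
  coxlen [arg min_(g < 1%g | carries g (source t) t) coxlen g]%N.

End Rank.

Lemma rev_ord_lt n (c d : 'I_n) : (rev_ord c < rev_ord d)%N = (d < c)%N.
Proof. by move: (ltn_ord c) (ltn_ord d) => /=; lia. Qed.

Section MapW.

Variables (F : fieldType) (n k : nat) (a : composition n k) (s : 'S_k).

Local Notation b := (rev_composition a).
Local Notation u := (w0conj s).

Definition complement (T : filling b) : filling b := [ffun x => rev_ord (T x)].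

Lemma complement_SPCT (T : filling b) : is_SPYRT s T -> is_SPCT u (complement T).
Proof.
move=> /and4P[/injectiveP Tinj T1 T2 T3].
have cE x y : (complement T x < complement T y)%N = (T y < T x)%N.
  by rewrite !ffunE rev_ord_lt.
apply/and4P; split.
- by apply/injectiveP => x y; rewrite !ffunE => /rev_ord_inj /Tinj.
- apply/forallP => i; pose f l := T (first_box b l).
  have finj : injective f by move=> x y /Tinj /(congr1 tag).
  have sE : #|[set j | (f j < f i)%N]| = s (rev_ord i).
    rewrite -(eqP (forallP T1 (rev_ord i))) /standardization rev_ordK -/(f i).
    rewrite -[RHS](card_imset _ (@rev_ord_inj k)); apply: eq_card => j.
    rewrite inE; apply/idP/imsetP => [ji|[l + ->]]; last first.
      by rewrite inE.
    by exists (rev_ord j); rewrite ?inE rev_ordK.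
  rewrite /w0conj !permM !permE /= -sE /standardization.
  rewrite (eq_card (B := [set j | (f i < f j)%N])); last first.
    by move=> j; rewrite !inE cE.
  have kE : (#|[set j | (f j < f i)%N]| + #|[set j | (f i < f j)%N]|.+1 = k)%N.
    rewrite -[RHS]card_ord -(cardsC [set j | (f j < f i)%N]); congr (_ + _)%N.
    have -> : ~: [set j | (f j < f i)%N] = i |: [set j | (f i < f j)%N].
      apply/setP => j; rewrite !inE -leqNgt leq_eqVlt eq_sym; congr (_ || _).
      by rewrite val_eqE (inj_eq finj).
    by rewrite cardsU1 inE ltnn.
  by apply/eqP; lia.
- apply/forallP => x; apply/forallP => y; apply/implyP => xy; rewrite cE.
  exact: implyP (forallP (forallP T2 x) y) xy.
- apply/forallP => x; apply/forallP => y; rewrite cE; apply/implyP => xy.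
  have /existsP[z /and3P[rz cz Tz]] := implyP (forallP (forallP T3 x) y) xy.
  by apply/existsP; exists z; rewrite rz cz cE Tz.
Qed.

(* tau_T *)
Definition tau (T : SPYRT a s) : SPCT b u :=
  Sub (complement (val T)) (complement_SPCT (valP T)).

Definition Rmod : vectType F := freemod F (SPYRT a s).
Definition Smod : vectType F := freemod F (SPCT b u).

Definition R_rule (act : H0 F n -> Rmod -> Rmod) : Prop :=
  forall (i : 'I_n.-1) (T : SPYRT a s),
    let v := act (hpi F i) (basis_vect F T) in
    if next_at (val T) i (@weakly_left n k b) then v = basis_vect F T
    else if next_at (val T) i (@right_adjacent n k b) then v = 0
    else exists2 T' : SPYRT a s, val T' = swap i (val T) & v = basis_vect F T'.

Definition W_map (v : Rmod) : 'Hom(Smod, F^o) :=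
  \sum_(T : SPYRT a s) v T *: ((-1) ^+ rank F (tau T) *: dual_vect F (tau T)).

Lemma W_map_linear : linear W_map.
Proof.
move=> c v w; rewrite /W_map scaler_sumr -big_split; apply: eq_bigr => T _ /=.
have -> : (c *: v + w) T = c * v T + w T by rewrite !ffunE.
by rewrite scalerDl -scalerA.
Qed.

Lemma W_map_basis T :
  W_map (basis_vect F T) = (-1) ^+ rank F (tau T) *: dual_vect F (tau T).
Proof.
rewrite /W_map (bigD1 T) //= ffunE eqxx scale1r big1 ?addr0 // => T' TT'.
by rewrite ffunE (negPf TT') scale0r.
Qed.

End MapW.

(* Main.v *)
Require Import Defs.
From mathcomp Require Import all_boot all_order all_algebra all_fingroup.
From mathcomp Require Import reals complex zify.

Set Implicit Arguments.
Unset Strict Implicit.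
Unset Printing Implicit Defensive.

Import GRing.Theory.
Local Open Scope ring_scope.

(** The twisted dual of the module on SPCT(b), b the reversed composition, is
    already a module, so the action on the span of SPYRT(a) is obtained by
    pulling it back along W once W is known to be bijective, and the only thing
    to verify is that the pulled back action obeys the stated rule.  Bijectivity
    is the statement that complementing the entries exchanges the two kinds of
    tableaux.

    In the twisted dual, pi_i sends the dual basis vector at t to that vector
    minus its composite with pi_j, j = n - i.  Let x and y be the boxes of j + 1
    and j in t.  The composite is governed by the tableaux which pi_j sends to t,
    and there are three cases ([Sgen_coef_left], [Sgen_coef_adjacent],
    [Sgen_coef_swap]): none if y is weakly left of x; only t if y is the box to
    the right of x; and t together with s_j t otherwise.  The third case rests on
    [SPCT_swap_down]: s_j t is then again a tableau.  So the result is the dual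
    vector at t, zero, or minus the dual vector at s_j t, and the signs of W turn
    this into the rule exactly when the ranks of t and s_j t differ by one.

    The rank is computed with column inversions, the pairs (x, y) of boxes with x
    in an earlier column than y and a larger entry in x.  A generator increases
    their number by one when it moves a tableau, so no element of length less
    than the difference of these numbers carries the source to t.  That this
    difference is attained needs the existence of a source in every equivalence
    class.  Going down by the swaps above ends in a [minimal] tableau t0, and the
    inversions of t0 turn out to be inversions of every equivalent tableau
    ([minimal_inversions]).  A tableau is determined within its class by its
    inversions, so every equivalent t goes down to t0 itself.  Reading the
    descent backwards gives a word that carries t0 to t and adds one inversion per
    letter ([minimal_reaches]).

    An element of the algebra acts through a chosen reduced word, which may
    differ from the word found.  Instead of comparing the two by braid moves, one
    notes that a word which adds as many inversions as it has letters must add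
    one at every step, and that this alone forces each of its letters to act by a
    swap ([act_swaps]). *)

(** * Column inversions of fillings *)

Section ColumnInversions.

Variables (n k : nat) (b : composition n k).
Implicit Types T : filling b.

Lemma swapK i : involutive (@swap n k b i).
Proof. by move=> T; apply/ffunP => x; rewrite !ffunE /stransp tpermK. Qed.

Lemma swap_inj i T : injective T -> injective (swap i T).
Proof. by move=> Tinj p q; rewrite !ffunE => /perm_inj /Tinj. Qed.

Lemma swap_lo i T x : T x = lo i -> swap i T x = hi i.
Proof. by move=> Tx; rewrite ffunE Tx /stransp tpermL. Qed.

Lemma swap_hi i T x : T x = hi i -> swap i T x = lo i.
Proof. by move=> Tx; rewrite ffunE Tx /stransp tpermR. Qed.

Lemma swap_lt i T x y p q : injective T -> T x = lo i -> T y = hi i ->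
  ~ (p = x /\ q = y) -> ~ (p = y /\ q = x) ->
  (swap i T p < swap i T q)%N = (T p < T q)%N.
Proof.
move=> Tinj Tx Ty h1 h2; rewrite !ffunE; apply: stransp_lt => -[pE qE].
  by apply: h1; split; apply: Tinj; rewrite ?Tx ?Ty.
by apply: h2; split; apply: Tinj; rewrite ?Tx ?Ty.
Qed.

Definition colinv T : {set box b * box b} :=
  [set p | (box_col p.1 < box_col p.2)%N && (T p.2 < T p.1)%N].

Lemma colinv_swap i T x y : injective T -> T x = lo i -> T y = hi i ->
  (box_col x < box_col y)%N ->
  (x, y) \notin colinv T /\ colinv (swap i T) = (x, y) |: colinv T.
Proof.
move=> Tinj Tx Ty xy; split; first by rewrite inE Tx Ty /= xy; lia.
apply/setP => -[p q]; rewrite !inE /= xpair_eqE.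
have [/andP[/eqP -> /eqP ->]|npq] /= := boolP ((p == x) && (q == y)).
  by rewrite xy (swap_lo Tx) (swap_hi Ty) /= ltnSn.
case: ltnP => // pq /=; apply: (swap_lt Tinj Tx Ty); last first.
  by case=> pE qE; rewrite pE qE !eqxx in npq.
by case=> pE qE; move: pq; rewrite pE qE; lia.
Qed.

Lemma colinv_swap_col i T x y : injective T -> T x = lo i -> T y = hi i ->
  box_col x = box_col y -> colinv (swap i T) = colinv T.
Proof.
move=> Tinj Tx Ty xy; apply/setP => -[p q]; rewrite !inE /=.
case: ltnP => // pq /=; apply: (swap_lt Tinj Tx Ty);
  by case=> pE qE; move: pq; rewrite pE qE xy ltnn.
Qed.

(** Swapping adds an inversion, removes one, or changes none, according to the
    relative position of the columns of i and i + 1. *)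
Lemma card_colinv_swap i T x y : injective T -> T x = lo i -> T y = hi i ->
  (#|colinv (swap i T)| <= #|colinv T|.+1
     ?= iff (box_col x < box_col y))%N.
Proof.
move=> Tinj Tx Ty; have [xy|yx|xy] := ltngtP (box_col x) (box_col y).
- have [nxy ->] := colinv_swap Tinj Tx Ty xy.
  by rewrite cardsU1 nxy; apply/leqif_refl.
- have [nyx] := colinv_swap (swap_inj (i := i) Tinj) (swap_hi Ty) (swap_lo Tx) yx.
  rewrite swapK => ->; rewrite cardsU1 nyx.
  by split; lia.
- by rewrite (colinv_swap_col Tinj Tx Ty xy); split; lia.
Qed.

(** Entries are permuted by g without asking that the result be a tableau: the
    counting arguments on words take place among all fillings. *)
Definition permute (g : 'S_n) T : filling b := [ffun x => g (T x)].

Lemma permute_cons i w T :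
  permute (word_perm (i :: w)) T = swap i (permute (word_perm w) T).
Proof.
by apply/ffunP => x; rewrite !ffunE -cat1s word_perm_cat word_perm1 permM.
Qed.

Lemma permute_nil T : permute (word_perm [::]) T = T.
Proof. by apply/ffunP => x; rewrite !ffunE /word_perm big_nil perm1. Qed.

Lemma permute_inj g T : injective T -> injective (permute g T).
Proof. by move=> Tinj p q; rewrite !ffunE => /perm_inj /Tinj. Qed.

Lemma card_colinv_word w T : injective T ->
  (#|colinv (permute (word_perm w) T)| <= #|colinv T| + size w)%N.
Proof.
move=> Tinj; elim: w => [|i w IHw]; first by rewrite permute_nil addn0.
have Pinj := permute_inj (g := word_perm w) Tinj.
have [x Px] := filling_surj Pinj (lo i); have [y Py] := filling_surj Pinj (hi i).
rewrite permute_cons (leq_trans (card_colinv_swap Pinj Px Py)) //=.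
by rewrite addnS ltnS.
Qed.

(** A letter adds at most one inversion, so a word that adds as many as it has
    letters must add one at each step. *)
Lemma colinv_word_grow i w T : injective T ->
  #|colinv (permute (word_perm (i :: w)) T)| = (#|colinv T| + (size w).+1)%N ->
  [/\ #|colinv (permute (word_perm w) T)| = (#|colinv T| + size w)%N
    & exists x y, [/\ permute (word_perm w) T x = lo i,
        permute (word_perm w) T y = hi i & (box_col x < box_col y)%N]].
Proof.
move=> Tinj; rewrite permute_cons; have Pinj := permute_inj (g := word_perm w) Tinj.
have [x Px] := filling_surj Pinj (lo i); have [y Py] := filling_surj Pinj (hi i).
have := card_colinv_word w Tinj; have [] := card_colinv_swap Pinj Px Py.
move=> h1 h2 h3 h4; have xy : (box_col x < box_col y)%N by rewrite -h2; lia.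
by split; [lia | exists x, y].
Qed.

Lemma colinv_word_sub w T : injective T ->
  #|colinv (permute (word_perm w) T)| = (#|colinv T| + size w)%N ->
  colinv T \subset colinv (permute (word_perm w) T).
Proof.
move=> Tinj; elim: w => [|i w IHw]; first by rewrite permute_nil.
case/(colinv_word_grow Tinj) => /IHw sub [x [y [Px Py xy]]].
have [_ E] := colinv_swap (permute_inj (g := word_perm w) Tinj) Px Py xy.
by rewrite permute_cons E (subset_trans sub) // subsetUr.
Qed.

Lemma row_box (y : box b) c : (c <= box_col y)%N ->
  exists z : box b, box_row z = box_row y /\ box_col z = c.
Proof.
move=> cy; have cb : (c < tnth b (tag y))%N.
  by rewrite (leq_ltn_trans cy) // ltn_ord.
by exists (Tagged (fun i => 'I_(tnth b i)) (Ordinal cb)).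
Qed.

(** A filling is recovered from the relative order of its entries because these
    exhaust 0, .., n - 1. *)
Lemma filling_rank T x : injective T -> T x = #|[set y | (T y < T x)%N]| :> nat.
Proof.
move=> Tinj; rewrite -(card_imset _ Tinj).
rewrite (_ : _ @: _ = [set c : 'I_n | (c < T x)%N]); last first.
  apply/setP => c; rewrite inE; apply/imsetP/idP => [[y + ->]|cx].
    by rewrite inE.
  by have [y Ty] := filling_surj Tinj c; exists y; rewrite // inE Ty.
by rewrite -sum1dep_card (big_ord_narrow (ltnW (ltn_ord (T x)))) sum1_card card_ord.
Qed.

End ColumnInversions.

(** * Descending in an equivalence class *)

Section Tableaux.

Variables (n k : nat) (b : composition n k) (u : 'S_k).
Implicit Types t : SPCT b u.

Lemma SPCT_row t x y : box_row x = box_row y -> (box_col x < box_col y)%N ->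
  (val t y < val t x)%N.
Proof.
case: t => t /= /and4P[_ _ h _] rxy cxy.
by apply: implyP (forallP (forallP h x) y) _; rewrite rxy eqxx.
Qed.

Lemma SPCT_triple t x y :
  (box_row x < box_row y)%N -> box_col y = (box_col x).+1 ->
  (val t y < val t x)%N ->
  exists z : box b, [/\ box_row z = box_row x, box_col z = box_col y
                      & (val t y < val t z)%N].
Proof.
case: t => t /= /and4P[_ _ _ h] rxy cxy txy.
have := implyP (forallP (forallP h x) y); rewrite rxy cxy eqxx txy => /(_ isT).
by case/existsP=> z /and3P[/eqP rz /eqP cz tz]; exists z.
Qed.

(** The swap changes the relative order of x and y only.  If y were in the next
    column and in a lower row, the triple condition would put to the right of x
    an entry larger than the one in y, yet smaller than the one in x, although
    these two are consecutive.  If y were further right in the row of x, the box next to x would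
    hold an entry strictly between them. *)
Lemma SPCT_swap_down i t x y : val t x = hi i -> val t y = lo i ->
  (box_col x < box_col y)%N -> ~~ right_adjacent x y ->
  is_SPCT u (swap i (val t)) /\ ~~ attacking x y.
Proof.
move=> tx ty xy nadj.
have txy : val t x = (val t y).+1 :> nat by rewrite tx ty.
have natt : ~~ attacking x y.
  apply/negP => /orP[/eqP E|/andP[/eqP cxy rxy]]; first by rewrite E ltnn in xy.
  have [|z [rz cz tz]] := SPCT_triple (t := t) rxy cxy; first by rewrite txy.
  have zx : (val t z < val t x)%N by apply: SPCT_row; rewrite // cz.
  by move: zx; rewrite txy ltnS leqNgt tz.
split=> //; have tinj := @SPCT_inj _ _ _ _ t.
have ltE p q : ~ (p = x /\ q = y) -> ~ (p = y /\ q = x) ->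
    (swap i (val t) p < swap i (val t) q)%N = (val t p < val t q)%N.
  by move=> h1 h2; apply: (swap_lt tinj ty tx).
have same_col p q : box_col p = box_col q ->
    (swap i (val t) p < swap i (val t) q)%N = (val t p < val t q)%N.
  by move=> pq; apply: ltE => -[pE qE]; move: xy; rewrite -pE -qE pq ltnn.
apply/and4P; split.
- exact/injectiveP/swap_inj.
- have /and4P[_ T1 _ _] := valP t; apply/forallP => l.
  rewrite -(eqP (forallP T1 l)) /standardization.
  by apply/eqP/eq_card => m; rewrite !inE same_col.
- apply/forallP => p; apply/forallP => q; apply/implyP => /andP[/eqP rpq cpq].
  rewrite ltE ?SPCT_row // => -[pE qE]; move: rpq cpq; rewrite pE qE => rpq cpq.
    by move: (ltn_trans xy cpq); rewrite ltnn.
  have [z [rz cz]] := row_box cpq; move: nadj.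
  rewrite /right_adjacent -rpq eqxx /= eqn_leq cpq andbT -ltnNge => lt1.
  have zx : (val t z < val t x)%N by apply: SPCT_row; rewrite ?rz ?cz.
  have yz : (val t y < val t z)%N by apply: SPCT_row; rewrite ?rz ?cz.
  by move: zx yz; lia.
- apply/forallP => p; apply/forallP => q; apply/implyP => /and3P[rpq /eqP cpq].
  rewrite ltE; first last.
  + case=> pE qE; move: rpq cpq natt; rewrite pE qE /attacking => -> ->.
    by rewrite eqxx orbT.
  + by case=> pE qE; move: cpq xy; rewrite pE qE; lia.
  case/(SPCT_triple rpq cpq) => z [rz cz tz].
  by apply/existsP; exists z; rewrite rz cz !eqxx same_col.
Qed.

Lemma equivalentP t1 t2 :
  reflect (forall x y, box_col x = box_col y ->
             (val t1 x < val t1 y)%N = (val t2 x < val t2 y)%N)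
          (equivalent t1 t2).
Proof.
apply: (iffP forallP) => [h x y xy|h x].
  by have /forallP/(_ y) := h x; rewrite xy eqxx => /eqP.
by apply/forallP => y; apply/implyP => /eqP /h ->.
Qed.

Lemma equivalent_refl t : equivalent t t.
Proof. exact/equivalentP. Qed.

Lemma equivalent_sym t1 t2 : equivalent t1 t2 -> equivalent t2 t1.
Proof. by move/equivalentP=> h; apply/equivalentP => x y /h. Qed.

Lemma equivalent_trans t1 t2 t3 :
  equivalent t1 t2 -> equivalent t2 t3 -> equivalent t1 t3.
Proof.
move=> /equivalentP h1 /equivalentP h2; apply/equivalentP => x y xy.
by rewrite h1 // h2.
Qed.

Lemma equivalent_swap i t1 t2 x y : val t2 = swap i (val t1) ->
  val t1 x = lo i -> val t1 y = hi i -> box_col x <> box_col y ->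
  equivalent t1 t2.
Proof.
move=> tE tx ty xy; apply/equivalentP => p q pq; rewrite tE.
by apply/esym; apply: (swap_lt (@SPCT_inj _ _ _ _ t1) tx ty) => -[pE qE];
  apply: xy; rewrite -pE -qE.
Qed.

(** The tableaux that admit no swap as in [SPCT_swap_down]; they turn out to be
    the sources of their classes. *)
Definition minimal t := forall i x y, val t x = hi i -> val t y = lo i ->
  (box_col x < box_col y)%N -> right_adjacent x y.

Lemma minimal_or_down t : minimal t \/
  exists i t' x y, [/\ val t = swap i (val t'), val t' x = lo i,
    val t' y = hi i, (box_col x < box_col y)%N & ~~ attacking x y].
Proof.
have [/existsP[i /existsP[x /existsP[y /and4P[/eqP tx /eqP ty xy nadj]]]]|none] :=
  boolP [exists i, exists x, exists y, [&& val t x == hi i, val t y == lo i,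
    (box_col x < box_col y)%N & ~~ right_adjacent x y]].
  have [tP natt] := SPCT_swap_down tx ty xy nadj; right.
  exists i, (Sub (swap i (val t)) tP), x, y; rewrite SubK swapK.
  by split; rewrite ?(swap_lo ty) ?(swap_hi tx).
left=> i x y tx ty xy; apply: contraNT none => nadj.
apply/existsP; exists i; apply/existsP; exists x; apply/existsP; exists y.
by rewrite tx ty !eqxx xy.
Qed.

(** Run through the values from that of y up to that of x and stop at the first
    one, after y, whose column is weakly left of that of y; w is its box and v the
    box of the value before.  If w is in the column of y, take it for z.  If it
    lies strictly left of y, it lies strictly left of v, so minimality makes v the
    right neighbour of w.  Hence v is in the column of y, which forces v = y, as
    the search would have stopped at v; then either w = x, or w serves as z. *)
Lemma minimal_between t x y : minimal t -> (box_col x < box_col y)%N ->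
  (val t y < val t x)%N ->
  right_adjacent x y \/
  exists z, [/\ (val t y < val t z < val t x)%N, (box_col x <= box_col z)%N
               & (box_col z <= box_col y)%N].
Proof.
move=> tmin xy tyx; have tinj := @SPCT_inj _ _ _ _ t.
pose P m := [exists w, [&& val t w == m :> nat, (val t y < m)%N
                         & (box_col w <= box_col y)%N]].
have exP : exists m, P m.
  by exists (val t x); apply/existsP; exists x; rewrite eqxx tyx ltnW.
case: (ex_minnP exP) => m /existsP[w /and3P[/eqP tw ym wy]] mmin.
have wx : (m <= val t x)%N.
  by apply: mmin; apply/existsP; exists x; rewrite eqxx tyx ltnW.
have m1n : (m.-1 < n.-1)%N by have := ltn_ord (val t w); rewrite tw; lia.
pose i := Ordinal m1n; have twi : val t w = hi i.
  by apply: val_inj; rewrite /= tw; lia.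
have [v tv] := filling_surj tinj (lo i).
have vm : val t v = m.-1 :> nat by rewrite tv.
have yv : (box_col y <= box_col v)%N.
  have [vy|nvy] := eqVneq v y; first by rewrite vy.
  rewrite leqNgt; apply/negP => vy; have : (m <= m.-1)%N; last by lia.
  apply: mmin; apply/existsP; exists v; rewrite vm eqxx (ltnW vy) andbT andTb.
  have : val t v != val t y :> nat by rewrite (inj_eq val_inj) (inj_eq tinj).
  by rewrite vm; lia.
have [wlty|ywle] := ltnP (box_col w) (box_col y); last first.
  right; exists w; rewrite tw ym ltn_neqAle wx wy (leq_trans (ltnW xy) ywle) !andbT.
  split=> //; rewrite -tw (inj_eq val_inj) (inj_eq tinj).
  by apply: contraTneq ywle => ->; rewrite -ltnNge.
have adj := tmin _ _ _ twi tv (leq_trans wlty yv).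
have cv : box_col v = (box_col w).+1 by apply/eqP; case/andP: adj.
have vy : v = y.
  apply/eqP/negPn/negP => nvy; have : (m <= m.-1)%N; last by lia.
  apply: mmin; apply/existsP; exists v; rewrite vm eqxx cv wlty andbT andTb.
  have : val t v != val t y :> nat by rewrite (inj_eq val_inj) (inj_eq tinj).
  by rewrite vm; lia.
rewrite vy in adj cv; have [wE|nwx] := eqVneq w x; first by left; rewrite -wE.
right; exists w; rewrite tw ym ltn_neqAle wx wy !andbT; split=> //.
  by rewrite -tw (inj_eq val_inj) (inj_eq tinj).
by move: xy; rewrite cv ltnS.
Qed.

(** By induction on the difference of the two entries, through a box whose entry
    and column both lie between those of x and y.  The base cases depend on the
    class only: two boxes in a column compare as prescribed by the class, and a
    row always decreases. *)
Lemma minimal_inversions t0 t x y : minimal t0 -> equivalent t0 t ->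
  (box_col x <= box_col y)%N -> (val t0 y < val t0 x)%N -> (val t y < val t x)%N.
Proof.
move=> t0min /equivalentP eqv.
have [d] := ubnP (val t0 x - val t0 y)%N; elim: d x y => // d IHd x y dxy.
rewrite leq_eqVlt => /orP[/eqP xy|xy] yx; first by rewrite -eqv.
case: (minimal_between t0min xy yx) => [/andP[/eqP rxy _]|[z [yzx xz zy]]].
  exact: SPCT_row.
by apply: (@ltn_trans (val t z)); apply: IHd => //; lia.
Qed.

Lemma minimal_colinv_sub t0 t : minimal t0 -> equivalent t0 t ->
  colinv (val t0) \subset colinv (val t).
Proof.
move=> t0min eqv; apply/subsetP => -[x y]; rewrite !inE /= => /andP[xy yx].
by rewrite xy (minimal_inversions t0min eqv (ltnW xy)).
Qed.

(** Boxes in one column are compared by the class, boxes in different columns by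
    the inversions; together these give the relative order of all entries. *)
Lemma equivalent_colinv_inj t1 t2 :
  equivalent t1 t2 -> colinv (val t1) = colinv (val t2) -> t1 = t2.
Proof.
move=> /equivalentP eqv /setP cE; apply: val_inj; apply/ffunP => x; apply: ord_inj.
have tinj t := @SPCT_inj _ _ _ _ t.
rewrite (filling_rank x (tinj t1)) (filling_rank x (tinj t2)).
apply: eq_card => y; rewrite !inE.
have flip t p q : p != q -> (val t p < val t q)%N = ~~ (val t q < val t p)%N.
  move=> pq; rewrite -leqNgt [RHS]leq_eqVlt (inj_eq val_inj) (inj_eq (tinj t)).
  by rewrite (negPf pq).
have [xy|yx|/esym xy] := ltngtP (box_col x) (box_col y); last exact: eqv.
  by have := cE (x, y); rewrite !inE xy.
have nyx : y != x by apply: contraTneq yx => ->; rewrite ltnn.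
by have := cE (y, x); rewrite !(flip _ _ _ nyx) !inE yx => /= ->.
Qed.

Lemma down_equivalent i t t' x y : val t = swap i (val t') ->
  val t' x = lo i -> val t' y = hi i -> (box_col x < box_col y)%N ->
  equivalent t' t /\ #|colinv (val t)| = #|colinv (val t')|.+1.
Proof.
move=> tE tx ty xy; split.
  by apply: (equivalent_swap tE tx ty) => E; rewrite E ltnn in xy.
have [nxy E] := colinv_swap (@SPCT_inj _ _ _ _ t') tx ty xy.
by rewrite tE E cardsU1 nxy.
Qed.

Lemma minimal_exists t : exists2 t0, minimal t0 & equivalent t0 t.
Proof.
have [m] := ubnP #|colinv (val t)|; elim: m t => // m IHm t tm.
case: (minimal_or_down t) => [tmin|[i [t' [x [y [tE tx ty xy natt]]]]]].
  by exists t; rewrite ?equivalent_refl.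
have [eqv cE] := down_equivalent tE tx ty xy.
have [|t0 t0min eqv0] := IHm t'; first by rewrite -ltnS -cE.
by exists t0 => //; apply: equivalent_trans eqv.
Qed.

(** A descent from t ends at a minimal tableau of the class; by
    [minimal_colinv_sub], applied both ways, the only one is t0. *)
Lemma minimal_reaches t0 t : minimal t0 -> equivalent t0 t ->
  exists w, val t = permute (word_perm w) (val t0) /\
            #|colinv (val t)| = (#|colinv (val t0)| + size w)%N.
Proof.
move=> t0min; have [m] := ubnP #|colinv (val t)|; elim: m t => // m IHm t tm eqv.
case: (minimal_or_down t) => [tmin|[i [t' [x [y [tE tx ty xy natt]]]]]].
  have <- : t0 = t.
    apply: (equivalent_colinv_inj eqv); apply/eqP; rewrite eqEsubset.
    by rewrite !minimal_colinv_sub // equivalent_sym.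
  by exists [::]; rewrite permute_nil addn0.
have [eqv' cE] := down_equivalent tE tx ty xy.
have [||w [t'E t'c]] := IHm t'; first by rewrite -ltnS -cE.
  exact/(equivalent_trans eqv)/equivalent_sym.
by exists (i :: w); rewrite permute_cons -t'E tE -tE cE t'c addnS.
Qed.

End Tableaux.

(** * Sources and ranks *)

Section Ranks.

Variables (F : fieldType) (n k : nat) (b : composition n k) (u : 'S_k).
Implicit Types t : SPCT b u.

Local Notation e t := (basis_vect F t).
Local Notation act w v := (foldr (@Sgen F n k b u) v w).

Lemma basis_vectE (I : finType) (x y : I) : basis_vect F x y = (y == x)%:R :> F.
Proof. exact: ffunE. Qed.

Lemma basis_vect_inj (I : finType) : injective (@basis_vect F I).
Proof.
move=> x y /ffunP/(_ x); rewrite !basis_vectE eqxx.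
by case: (eqVneq x y) => // _ /eqP; rewrite oner_eq0.
Qed.

Lemma basis_vect_neq0 (I : finType) (x : I) : basis_vect F x <> 0.
Proof.
by move/ffunP/(_ x)/eqP; rewrite basis_vectE eqxx ffunE oner_eq0.
Qed.

Lemma Sact_gen i (v : freemod F (SPCT b u)) : Sact (hpi F i) v = Sgen i v.
Proof.
exact: (hact_pi (@Sgen_linear F n k b u) (@Sgen_idem F n k b u)
          (@Sgen_braid F n k b u) (@Sgen_comm F n k b u)).
Qed.

Lemma Sact_word w (v : freemod F (SPCT b u)) :
  Sact (\prod_(i <- w) hpi F i) v = act w v.
Proof.
have [_ _ act1 actM] := Sact_action F b u.
by elim: w => [|i w IHw] /=; rewrite ?big_nil // big_cons actM Sact_gen IHw.
Qed.

Lemma carriesP g t1 t2 : reflect (act (reduced g) (e t1) = e t2) (carries F g t1 t2).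
Proof. by rewrite /carries /hpi_perm Sact_word; apply: eqP. Qed.

(** The letters that act by a swap form a subword w', which alone already moves
    t1 to t2 and adds one inversion per letter. *)
Lemma act_word w t1 : act w (e t1) = 0 \/
  exists t2 w', [/\ act w (e t1) = e t2, val t2 = permute (word_perm w') (val t1),
    #|colinv (val t2)| = (#|colinv (val t1)| + size w')%N & (size w' <= size w)%N].
Proof.
elim: w => [|i w IHw]; first by right; exists t1, [::]; rewrite permute_nil addn0.
rewrite -[act (i :: w) _]/(Sgen i (act w (e t1))).
case: IHw => [-> | [t [w' [-> tE tc sw]]]]; first by left; exact: Sgen0.
have tinj := @SPCT_inj _ _ _ _ t.
have [x tx] := filling_surj tinj (lo i); have [y ty] := filling_surj tinj (hi i).
case: (box_cases x y) => [xy|xy|[xy nxy]].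
- by right; exists t, w'; rewrite (SgenL F tx ty xy) leqW.
- by left; exact: SgenZ tx ty xy.
right; exists (SPCT_swap i t), (i :: w'); have sE := SPCT_swapE tx ty xy nxy.
rewrite (SgenS F tx ty xy nxy) permute_cons -tE; split=> //.
by have [_ ->] := down_equivalent sE tx ty xy; rewrite tc addnS.
Qed.

(** Since inversions are never lost along such a word, a pair that becomes an
    inversion at some step was not one in t1; it is therefore not a pair of row
    neighbours, whose entries decrease in t1, and [SPCT_swap_down] says that the
    filling before this step was a tableau, moved by the letter. *)
Lemma act_swaps w t1 t2 : val t2 = permute (word_perm w) (val t1) ->
  #|colinv (val t2)| = (#|colinv (val t1)| + size w)%N -> act w (e t1) = e t2.
Proof.
elim: w t2 => [|i w IHw] t2 tE tc.
  by congr (e _); apply: val_inj; rewrite tE permute_nil.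
have t1inj := @SPCT_inj _ _ _ _ t1; move: tc; rewrite tE.
case/(colinv_word_grow t1inj)=> Pc [x [y [Px Py xy]]].
have sub := colinv_word_sub t1inj Pc.
move: tE; rewrite permute_cons; move: Pc Px Py sub IHw.
set P := permute _ _ => Pc Px Py sub IHw tE.
have nadj : ~~ right_adjacent x y.
  apply/negP => /andP[/eqP ryx _]; have t1yx := SPCT_row t1 (esym ryx) xy.
  have := subsetP sub (x, y); rewrite !inE /= xy t1yx Px Py /=.
  by move/(_ isT); rewrite ltnNge leqnSn.
have t2x : val t2 x = hi i by rewrite tE swap_lo.
have t2y : val t2 y = lo i by rewrite tE swap_hi.
have [] := SPCT_swap_down t2x t2y xy nadj; rewrite tE swapK => PP natt.
pose t : SPCT b u := Sub P PP; have tP : val t = P by rewrite SubK.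
rewrite /= (IHw t) ?tP // (SgenS F (T := t) _ _ xy natt) ?tP //; congr (e _).
by apply: val_inj; rewrite (SPCT_swapE (T := t) _ _ xy natt) ?tP.
Qed.

(** The reduced word of the permutation of w is no longer than w and has to add
    the same number of inversions, so it has the same length and [act_swaps]
    applies to it as well. *)
Lemma carries_reached w t1 t2 : val t2 = permute (word_perm w) (val t1) ->
  #|colinv (val t2)| = (#|colinv (val t1)| + size w)%N ->
  carries F (word_perm w) t1 t2 /\ coxlen (word_perm w) = size w.
Proof.
move=> tE tc; set g := word_perm w; have gE : word_perm (reduced g) = g := reducedP g.
have t1inj := @SPCT_inj _ _ _ _ t1.
have := card_colinv_word (reduced g) t1inj; rewrite gE -tE tc size_tuple leq_add2l.
move=> wg; have sg : coxlen g = size w by apply/eqP; rewrite eqn_leq coxlen_min.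
split=> //; apply/carriesP/act_swaps; first by rewrite gE.
by rewrite size_tuple sg.
Qed.

Lemma carries_shortest g t1 t2 : carries F g t1 t2 ->
  exists2 g', carries F g' t1 t2 &
    (#|colinv (val t2)| = #|colinv (val t1)| + coxlen g')%N /\
    (coxlen g' <= coxlen g)%N.
Proof.
move/carriesP=> gt.
case: (act_word (reduced g) t1); first by rewrite gt => /basis_vect_neq0.
case=> t [w []]; rewrite gt size_tuple => /basis_vect_inj <- tE tc wg.
have [wt wl] := carries_reached tE tc; exists (word_perm w) => //.
by rewrite wl.
Qed.

(** Frees the rank from its default element, which need not carry the source to
    the tableau. *)
Lemma arg_minn_default (I : finType) (P : pred I) (f : I -> nat) i0 i1 :
  P i1 -> [arg min_(i < i0 | P i) f i] = [arg min_(i < i1 | P i) f i].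
Proof.
move=> P1; rewrite /arg_min /extremum; case: pickP => // none.
case: (arg_minnP f P1) => i Pi imin; have := none i.
by rewrite /= Pi => /forallP[] j; apply/implyP/imin.
Qed.

Lemma colinv_carried g0 t1 t2 : carries F g0 t1 t2 ->
  (#|colinv (val t1)| + coxlen [arg min_(g < 1%g | carries F g t1 t2) coxlen g])%N
  = #|colinv (val t2)|.
Proof.
move=> g0P; rewrite (arg_minn_default (P := fun g => carries F g t1 t2) _ _ g0P).
case: arg_minnP => // g gP gmin.
have [g' g'P [-> gg']] := carries_shortest gP; congr addn.
by apply/eqP; rewrite eqn_leq gmin.
Qed.

Lemma minimal_is_source t0 : minimal t0 -> is_source F t0.
Proof.
move=> t0min; apply/forallP => t; apply/implyP => eqv.
have [w [tE tc]] := minimal_reaches t0min (equivalent_sym eqv).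
by have [wP _] := carries_reached tE tc; apply/existsP; exists (word_perm w).
Qed.

Lemma sourceP t : equivalent (source F t) t && is_source F (source F t).
Proof.
rewrite /source; case: pickP => // none; have [t0 t0min eqv] := minimal_exists t.
by have := none t0; rewrite eqv minimal_is_source.
Qed.

Lemma source_equivalent t1 t2 : equivalent t1 t2 -> source F t1 = source F t2.
Proof.
move=> eqv; have := sourceP t2; rewrite /source.
rewrite (eq_pick (Q := fun t0 => equivalent t0 t2 && is_source F t0)).
  case: pickP => // none; have [t0 t0min eqv0] := minimal_exists t2.
  by have := none t0; rewrite eqv0 minimal_is_source.
move=> t0 /=; congr (_ && _).
by apply/idP/idP => /equivalent_trans; apply; rewrite // equivalent_sym.
Qed.

(** Makes the rank additive along swaps: the source is common to the class, so
    only the number of inversions varies. *)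
Lemma rank_colinv t :
  (#|colinv (val (source F t))| + rank F t)%N = #|colinv (val t)|.
Proof.
have /andP[eqv /forallP/(_ t)] := sourceP t.
rewrite (equivalent_sym eqv) => /existsP[g gP].
exact: colinv_carried gP.
Qed.

Lemma rank_swap i t t' x y : val t = swap i (val t') ->
  val t' x = lo i -> val t' y = hi i -> (box_col x < box_col y)%N ->
  rank F t = (rank F t').+1.
Proof.
move=> tE tx ty xy; have [eqv tc] := down_equivalent tE tx ty xy.
have := rank_colinv t; rewrite -(source_equivalent eqv) tc -(rank_colinv t').
by rewrite -addnS => /addnI.
Qed.

(** The coefficients of t in the images of all t' under pi_i form the row of the
    matrix of pi_i that describes the composite of the dual vector at t with it. *)

Variables (i : 'I_n.-1) (t : SPCT b u) (x y : box b).
Hypotheses (tx : val t x = hi i) (ty : val t y = lo i).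

Lemma Sgen_coef_neq0 t' : Sgen i (e t') t != 0 ->
  (t' = t \/ val t' = swap i (val t)) /\ (box_col x < box_col y)%N.
Proof.
have t'inj := @SPCT_inj _ _ _ _ t'.
have [x' tx'] := filling_surj t'inj (lo i).
have [y' ty'] := filling_surj t'inj (hi i).
case: (box_cases x' y') => [xy|xy|[xy nxy]].
- rewrite (SgenL F tx' ty' xy) basis_vectE.
  case: (eqVneq t t') => [E _|_]; last by rewrite eqxx.
  rewrite -E in tx' ty' t'inj; split; first by left.
  have -> : x = y' by apply: t'inj; rewrite tx ty'.
  by have -> : y = x' by apply: t'inj; rewrite ty tx'.
- by rewrite (SgenZ F tx' ty' xy) ffunE eqxx.
rewrite (SgenS F tx' ty' xy nxy) basis_vectE.
case: (eqVneq t _) => [E _|_]; last by rewrite eqxx.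
have tE : val t = swap i (val t') by rewrite E (SPCT_swapE tx' ty' xy nxy).
have tinj := @SPCT_inj _ _ _ _ t.
split; first by right; rewrite tE swapK.
have -> : x = x' by apply: tinj; rewrite tx tE swap_lo.
by have -> : y = y' by apply: tinj; rewrite ty tE swap_hi.
Qed.

Lemma Sgen_coef_diag : (box_col x < box_col y)%N -> Sgen i (e t) t = 1.
Proof. by move=> xy; rewrite (SgenL F ty tx xy) basis_vectE eqxx. Qed.

Lemma Sgen_coef_left t' : (box_col y <= box_col x)%N -> Sgen i (e t') t = 0.
Proof.
move=> yx; apply/eqP; apply: contraTT yx => /Sgen_coef_neq0[_ xy].
by rewrite -ltnNge.
Qed.

(** Exchanging two neighbours in a row destroys its monotonicity, so t is not
    reached by a swap. *)
Lemma Sgen_coef_adjacent t' :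
  right_adjacent x y -> Sgen i (e t') t = (t == t')%:R.
Proof.
case/andP=> /eqP ryx /eqP cyx.
have xy : (box_col x < box_col y)%N by rewrite cyx.
have [<-|ntt'] := eqVneq t t'; first exact: Sgen_coef_diag.
apply/eqP/negPn/negP => /Sgen_coef_neq0[[E|t'E] _].
  by rewrite E eqxx in ntt'.
have := SPCT_row t' (esym ryx) xy; rewrite t'E swap_lo // swap_hi //=.
by rewrite ltnNge leqnSn.
Qed.

Lemma Sgen_coef_swap : (box_col x < box_col y)%N -> ~~ right_adjacent x y ->
  exists t1, [/\ val t1 = swap i (val t), rank F t = (rank F t1).+1
    & forall t', Sgen i (e t') t = (t == t')%:R + (t1 == t')%:R].
Proof.
move=> xy nadj; have [t1P natt] := SPCT_swap_down tx ty xy nadj.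
pose t1 : SPCT b u := Sub (swap i (val t)) t1P; exists t1.
have t1E : val t1 = swap i (val t) by rewrite SubK.
have tE : val t = swap i (val t1) by rewrite t1E swapK.
have t1x : val t1 x = lo i by rewrite t1E swap_hi.
have t1y : val t1 y = hi i by rewrite t1E swap_lo.
have nt1 : t != t1.
  by apply/negP => /eqP E; have := congr1 (@nat_of_ord n) t1x; rewrite -E tx /=; lia.
split=> // [|t']; first exact: (rank_swap tE t1x t1y xy).
have [<-|ntt'] := eqVneq t t'.
  by rewrite Sgen_coef_diag // eq_sym (negPf nt1) addr0.
have [<-|nt1t'] := eqVneq t1 t'.
  rewrite (SgenS F t1x t1y xy natt) basis_vectE add0r.
  rewrite (_ : SPCT_swap i t1 = t) ?eqxx //.
  by apply: val_inj; rewrite (SPCT_swapE t1x t1y xy natt).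
rewrite addr0; apply/eqP/negPn/negP => /Sgen_coef_neq0[[E|t'E] _].
  by rewrite E eqxx in ntt'.
by case/eqP: nt1t'; apply: val_inj; rewrite t1E.
Qed.

End Ranks.

Lemma transport_action (F : fieldType) (n : nat) (V W : lmodType F)
    (f : V -> W) (g : W -> V) (actW : H0 F n -> W -> W) :
  linear f -> cancel f g -> cancel g f -> is_H0_action actW ->
  is_H0_action (fun a v => g (actW a (f v))) /\
  is_H0_isomorphism (fun a v => g (actW a (f v))) actW f.
Proof.
move=> fL fK gK [actL actLl act1 actM].
have gL : linear g by move=> c v w; apply: (can_inj fK); rewrite fL !gK.
split; split.
- by move=> x c v w; rewrite fL actL gL.
- by move=> v c x y; rewrite actLl gL.
- by move=> v; rewrite act1 fK.
- by move=> x y v; rewrite actM gK.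
- exact: fL.
- by exists g.
- by move=> x v; rewrite gK.
Qed.

(** * The two kinds of tableaux and the map W *)

Section Complement.

Variables (n k : nat) (a : composition n k) (s : 'S_k).

Local Notation b := (rev_composition a).

Lemma complementK : involutive (@complement n k a).
Proof. by move=> T; apply/ffunP => x; rewrite !ffunE rev_ordK. Qed.

Lemma rev_lo (i : 'I_n.-1) : rev_ord (lo i) = hi (rev_ord i).
Proof. by apply: val_inj => /=; have := ltn_ord i; lia. Qed.

Lemma rev_hi (i : 'I_n.-1) : rev_ord (hi i) = lo (rev_ord i).
Proof. by apply: val_inj => /=; have := ltn_ord i; lia. Qed.

Lemma complement_swap i (T : filling b) :
  complement (swap i T) = swap (rev_ord i) (complement T).
Proof.
apply/ffunP => x; rewrite !ffunE /stransp (inj_tperm _ _ _ (@rev_ord_inj n)).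
by rewrite rev_lo rev_hi tpermC.
Qed.

(** All comparisons are reversed.  For the first column, reversing both the
    positions and the values of a standardized word is conjugation by the longest
    permutation, an involution. *)
Lemma complement_SPYRT (T : filling b) :
  is_SPCT (w0conj s) T -> is_SPYRT s (complement T).
Proof.
move=> /and4P[/injectiveP Tinj T1 T2 T3].
have cE x y : (complement T x < complement T y)%N = (T y < T x)%N.
  by rewrite !ffunE rev_ord_lt.
apply/and4P; split.
- by apply/injectiveP => x y; rewrite !ffunE => /rev_ord_inj /Tinj.
- apply/forallP => i; pose f l := T (first_box b l).
  have finj : injective f by move=> p q /Tinj /(congr1 tag).
  have sE : #|[set j | (f j < f (rev_ord i))%N]| = rev_ord (s i) :> nat.
    have := eqP (forallP T1 (rev_ord i)).
    by rewrite /w0conj !permM !permE rev_ordK.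
  have cardE : #|[set j | (f (rev_ord i) < f j)%N]| = s i.
    have := cardsC [set j | (f j < f (rev_ord i))%N]; rewrite sE card_ord.
    have -> : ~: [set j | (f j < f (rev_ord i))%N]
            = rev_ord i |: [set j | (f (rev_ord i) < f j)%N].
      apply/setP => j; rewrite !inE -leqNgt leq_eqVlt eq_sym; congr (_ || _).
      by rewrite (inj_eq val_inj) (inj_eq finj).
    by rewrite cardsU1 inE ltnn /=; have := ltn_ord (s i); lia.
  rewrite -cardE /standardization -[X in _ == X](card_imset _ (@rev_ord_inj k)).
  apply/eqP/eq_card => j; rewrite inE cE; apply/idP/imsetP => [ij|[l + ->]].
    by exists (rev_ord j); rewrite ?inE ?rev_ordK.
  by rewrite inE rev_ordK.
- apply/forallP => x; apply/forallP => y; apply/implyP => xy; rewrite cE.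
  exact: implyP (forallP (forallP T2 x) y) xy.
- apply/forallP => x; apply/forallP => y; rewrite cE; apply/implyP => xy.
  have /existsP[z /and3P[rz cz Tz]] := implyP (forallP (forallP T3 x) y) xy.
  by apply/existsP; exists z; rewrite rz cz cE Tz.
Qed.

Definition untau (t : SPCT b (w0conj s)) : SPYRT a s :=
  Sub (complement (val t)) (complement_SPYRT (valP t)).

Lemma tauK : cancel (@tau n k a s) untau.
Proof. by move=> T; apply: val_inj; rewrite /= complementK. Qed.

Lemma untauK : cancel untau (@tau n k a s).
Proof. by move=> t; apply: val_inj; rewrite /= complementK. Qed.

End Complement.

Section Duality.

Variables (F : fieldType) (n k : nat) (a : composition n k) (s : 'S_k).

Local Notation b := (rev_composition a).
Local Notation e T := (basis_vect F T).
Local Notation sgn T := ((-1) ^+ rank F (tau T) : F).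

Implicit Types (T : SPYRT a s) (v : Rmod F a s) (d : 'Hom(Smod F a s, F^o)).

Lemma W_mapE v T : W_map v (e (tau T)) = sgn T * v T.
Proof.
rewrite /W_map sum_lfunE (bigD1 T) //= big1 => [|T' TT'];
  rewrite !scale_lfunE dual_vectE basis_vectE.
  by rewrite eqxx addr0 /GRing.scale /= mulr1 mulrC.
by rewrite (inj_eq (can_inj (@tauK _ _ _ _))) (negPf TT') !scaler0.
Qed.

Lemma basis_tauE T T' : basis_vect F T T' = (tau T' == tau T)%:R :> F.
Proof. by rewrite basis_vectE (inj_eq (can_inj (@tauK _ _ _ _))). Qed.

(** W is diagonal in the basis and its dual, with entries that square to 1. *)
Definition W_inv d : Rmod F a s := [ffun T => sgn T * d (e (tau T))].

Lemma W_mapK : cancel (@W_map F n k a s) W_inv.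
Proof.
by move=> v; apply/ffunP => T; rewrite ffunE W_mapE mulrA -expr2 sqrr_sign mul1r.
Qed.

Lemma W_invK : cancel W_inv (@W_map F n k a s).
Proof.
move=> d; apply/lfunP; apply: linear_ext => [||t].
- exact: linearP.
- exact: linearP.
have [T tE] : exists T, t = tau T by exists (untau t); exact/esym/untauK.
by rewrite tE W_mapE ffunE mulrA -expr2 sqrr_sign mul1r.
Qed.

Definition Ract (x : H0 F n) v : Rmod F a s :=
  W_inv (twisted_dual (@Sact F n k b (w0conj s)) x (W_map v)).

Lemma Ract_coef i T T' : Ract (hpi F i) (e T) T' =
  sgn T' * (sgn T * ((tau T == tau T')%:R - Sgen (rev_ord i) (e (tau T')) (tau T))).
Proof.
have SP := Sact_action F b (w0conj s); have [_ SL S1 _] := SP.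
rewrite ffunE twisted_dualE // omega_pi W_map_basis scale_lfunE dual_vectE.
congr (_ * (_ * _)).
have -> : 1 - hpi F (rev_ord i) = (-1) *: hpi F (rev_ord i) + 1.
  by rewrite scaleN1r addrC.
by rewrite SL S1 Sact_gen scaleN1r !ffunE addrC.
Qed.

Lemma freemod0E (I : finType) (x : I) : (0 : freemod F I) x = 0 :> F.
Proof. exact: ffunE. Qed.

Lemma sign_diag (I : finType) (r : I -> nat) (t t' : I) :
  (-1) ^+ r t' * ((-1) ^+ r t * (t == t')%:R) = (t' == t)%:R :> F.
Proof.
rewrite [RHS](_ : _ = (t == t')%:R); last by rewrite eq_sym.
case: (eqVneq t t') => [<-|_]; last by rewrite !mulr0.
by rewrite mulr1 -expr2 sqrr_sign.
Qed.

Lemma Ract_rule : R_rule Ract.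
Proof.
move=> i T; rewrite /=; have /and4P[/injectiveP Tinj _ _ _] := valP T.
have [x Tx] := filling_surj Tinj (lo i); have [y Ty] := filling_surj Tinj (hi i).
rewrite !(next_atE _ Tinj Tx Ty).
have tx : val (tau T) x = hi (rev_ord i) by rewrite ffunE Tx rev_lo.
have ty : val (tau T) y = lo (rev_ord i) by rewrite ffunE Ty rev_hi.
rewrite /weakly_left; have [yx|xy] := leqP (box_col y) (box_col x).
  apply/ffunP => T'; rewrite Ract_coef (Sgen_coef_left F tx ty) // subr0 basis_tauE.
  exact: sign_diag.
case: ifP => [adj|/negbT nadj].
  apply/ffunP => T'; rewrite Ract_coef (Sgen_coef_adjacent F tx ty) // subrr.
  have mul00 (c d : F) : c * (d * 0) = 0 by rewrite !mulr0.
  exact: etrans (mul00 _ _) (esym (freemod0E _)).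
have [t1 [t1E rE cE]] := Sgen_coef_swap F tx ty xy nadj.
have T1E : val (untau t1) = swap i (val T).
  by rewrite /= t1E complement_swap /= complementK rev_ordK.
exists (untau t1) => //; apply/ffunP => T'; rewrite Ract_coef cE.
(* The minus sign of the dual action cancels against the step in rank. *)
rewrite opprD addrA subrr add0r basis_tauE (untauK t1) rE exprS mulN1r.
rewrite mulrNN; exact: sign_diag.
Qed.

End Duality.

Theorem proposition4p11 (R : realType) (n k : nat) (a : composition n k)
    (s : 'S_k) :
  exists act : H0 R[i] n -> Rmod R[i] a s -> Rmod R[i] a s,
    [/\ is_H0_action act,
        R_rule act
      & is_H0_isomorphism act
          (twisted_dual (@Sact R[i] n k (rev_composition a) (w0conj s)))
          (@W_map R[i] n k a s)].
Proof.
exists (@Ract R[i] n k a s).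
have [RP RW] := transport_action (@W_map_linear _ _ _ _ _) (@W_mapK _ _ _ _ _)
  (@W_invK _ _ _ _ _)
  (twisted_dual_action (Sact_action R[i] (rev_composition a) (w0conj s))).
by split=> //; exact: Ract_rule.
Qed.
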